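(* Let $\mathcal{A}=(\mathcal{A}_1,\dots,\mathcal{A}_n)$ be a family of finite sets in $(\mathbb{Z}_{\ge 0})^n$ and let $\mathbf{f}=(f_1,\dots,f_n)$ be a generic sparse system of polynomials in $\mathbb{C}[x_1,\dots,x_n]$ supported on $\mathcal{A}$. For $\widetilde I\subset\{1,\dots,n\}$ put $J_{\widetilde I}=\{j\in\{1,\dots,n\} \mid \exists a\in\mathcal{A}_j:\ a_i=0\ \forall i\in \widetilde I\}$. Assume that $\emptyset\ne I\subset\{1,\dots,n\}$ satisfies: (A1) $\#I+\#J_I=n$; (A2) for every $\widetilde I\subset I$, $\#\widetilde I+\#J_{\widetilde I}\ge n$; (A3) for every $J\subset J_I$, $\dim\big(\sum_{j\in J}\mathcal{A}_j^I\big)\ge \#J$, where $\mathcal{A}_j^I=\{a\in\mathcal{A}_j\mid a_i=0\ \forall i\in I\}$. Let $\zeta\in\mathbb{C}^n$ be an isolated zero of $\mathbf{f}$ with $\zeta\in O_I:=\{x\in\mathbb{C}^n\mid x_i=0\text{ if and only if } i\in I\}$. Then $$\mathrm{mult}_\zeta(\mathbf{f})=\mathrm{mult}_0(\mathbf{g})$$ for a system $\mathbf{g}:=(g_j)_{j\notin J_I}$ of generic polynomials (in $\#I$ variables) with supports $\mathcal{B}_j^I:=\pi_I(\mathcal{A}_j)$ for every $j\notin J_I$, where $\pi_I:\mathbb{Z}^n\to\mathbb{Z}^{\#I}$ is the projection onto the coordinates indexed by $I$.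
   Context: A system supported on a family $(\mathcal{C}_1,\dots,\mathcal{C}_m)$ of finite subsets of $(\mathbb{Z}_{\ge0})^m$ is a tuple $(f_1,\dots,f_m)$ with $f_j=\sum_{a\in\mathcal{C}_j}c_{j,a}x^a$ and all $c_{j,a}\in\mathbb{C}\setminus\{0\}$. A statement holds for a generic system if it holds for all coefficient vectors in some non-empty Zariski open subset of $\mathbb{C}^{\#\mathcal{C}_1}\times\dots\times\mathbb{C}^{\#\mathcal{C}_m}$. In particular the right-hand side $\mathrm{mult}_0(\mathbf{g})$ denotes the multiplicity of the origin of $\mathbb{C}^{\#I}$ as an isolated zero of a generic system with the given supports; this is a single number, equal to the minimum of the multiplicity of the origin over all systems with coefficients on these supports having the origin as an isolated zero. By (A1), the number of indices $j\notin J_I$ is exactly $\#I$. For an isolated zero $\zeta\in\mathbb{C}^m$ of $\mathbf{f}=(f_1,\dots,f_m)$, $\mathrm{mult}_\zeta(\mathbf{f})$ is the dimension as a $\mathbb{C}$-vector space of $\mathbb{C}[x]_{\mathfrak{m}_\zeta}/(f_1,\dots,f_m)\mathbb{C}[x]_{\mathfrak{m}_\zeta}$, where $\mathfrak{m}_\zeta=(x_1-\zeta_1,\dots,x_m-\zeta_m)$. The dimension of a Minkowski sum of finite sets is the dimension of its affine hull. *)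

(* Defs.v *)
(* The field of complex numbers is R[i], for R a realType. *)
From mathcomp Require Export all_boot all_order all_algebra.
From mathcomp Require Export finmap reals complex mpoly.

Set Implicit Arguments.
Unset Strict Implicit.
Unset Printing Implicit Defensive.

Import Order.TTheory GRing.Theory Num.Theory.

Local Open Scope ring_scope.
Local Open Scope complex_scope.
Local Open Scope fset_scope.

Section Systems.
Variables (R : realType) (n : nat) (K : finType).

(* The monomial indexed by (j, a) is the term x^a of the j-th polynomial, so
   coeffs A is the product over j of the spaces C^(#A_j). *)
Definition coeffs (A : K -> {fset 'X_{1..n}}) : Type :=
  {j : K & A j} -> R[i].

Definition sparse_system (A : K -> {fset 'X_{1..n}}) (c : coeffs A)
    (j : K) : {mpoly R[i][n]} :=
  \sum_(a : A j) c (Tagged (fun j => A j) a) *: 'X_[val a].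

Definition is_zero (f : K -> {mpoly R[i][n]}) (z : 'I_n -> R[i]) : Prop :=
  forall j, (f j).@[z] = 0.

Definition isolated_zero (f : K -> {mpoly R[i][n]}) (zeta : 'I_n -> R[i]) :
    Prop :=
  is_zero f zeta /\
  exists2 e : R, 0 < e &
    forall z : 'I_n -> R[i], (forall i, `|z i - zeta i| < e%:C) ->
      is_zero f z -> forall i, z i = zeta i.

(* The local ring C[x]_{m_zeta} and the extension to it of the ideal generated
   by f, both realized inside the fraction field C(x). *)
Definition local_ring (zeta : 'I_n -> R[i]) (u : {fraction {mpoly R[i][n]}}) :
    Prop :=
  exists p q : {mpoly R[i][n]}, q.@[zeta] != 0 /\ u = tofrac p / tofrac q.

Definition local_ideal (f : K -> {mpoly R[i][n]}) (zeta : 'I_n -> R[i])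
    (u : {fraction {mpoly R[i][n]}}) : Prop :=
  exists h : K -> {fraction {mpoly R[i][n]}},
    (forall j, local_ring zeta (h j)) /\ u = \sum_j h j * tofrac (f j).

End Systems.

(* For C-linear subspaces W <= V of C(x), the quotient V / W has dimension d:
   the classes of some b_0, ..., b_(d-1) in V form a basis of V / W. *)
Definition has_quotient_dim (R : realType) (n : nat)
    (V W : {fraction {mpoly R[i][n]}} -> Prop) (d : nat) : Prop :=
  exists b : 'I_d -> {fraction {mpoly R[i][n]}},
    (forall k, V (b k)) /\
    forall u, V u ->
      exists! c : 'rV[R[i]]_d, W (u - \sum_k tofrac (c 0 k)%:MP * b k).

Definition has_multiplicity (R : realType) (n : nat) (K : finType)
    (f : K -> {mpoly R[i][n]}) (zeta : 'I_n -> R[i]) (d : nat) : Prop :=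
  has_quotient_dim (local_ring zeta) (local_ideal f zeta) d.

(* A Zariski open set is the complement of the common zero locus of a family S
   of polynomials; the affine space C^T is identified with C^#|T| through the
   enumeration of T. *)
Definition zariski_open (R : realType) (T : finType) (U : (T -> R[i]) -> Prop) :
    Prop :=
  exists S : {mpoly R[i][#|T|]} -> Prop,
    forall c, U c <-> exists2 p, S p & p.@[fun k => c (enum_val k)] != 0.

(* Systems supported on A have all their coefficients nonzero, so U is required
   to consist of such coefficient vectors; this is no restriction, as one can
   intersect U with the complement of the coordinate hyperplanes. *)
Definition generically (R : realType) (n : nat) (K : finType)
    (A : K -> {fset 'X_{1..n}}) (P : (K -> {mpoly R[i][n]}) -> Prop) : Prop :=
  exists U : coeffs R A -> Prop,
    [/\ zariski_open U, exists c, U c &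
        forall c, U c -> (forall t, c t != 0) /\ P (sparse_system c)].

Section Supports.
Variable n : nat.

Definition J_ (A : 'I_n -> {fset 'X_{1..n}}) (I : {set 'I_n}) : {set 'I_n} :=
  [set j | [exists a : A j, [forall i in I, val a i == 0%N]]].

Definition restr (I : {set 'I_n}) (A : 'I_n -> {fset 'X_{1..n}}) (j : 'I_n) :
    {fset 'X_{1..n}} :=
  [fset a in A j | [forall i in I, a i == 0%N]].

Definition proj_mnm (I : {set 'I_n}) (a : 'X_{1..n}) : 'X_{1..#|I|} :=
  [multinom a (enum_val i) | i < #|I|].

Definition proj_supp (I : {set 'I_n}) (B : {fset 'X_{1..n}}) :
    {fset 'X_{1..#|I|}} :=
  [fset proj_mnm I a | a in B].

Definition minkowski (B C : {fset 'X_{1..n}}) : {fset 'X_{1..n}} :=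
  [fset (p.1 + p.2)%MM | p in B `*` C].

Definition minkowski_sum (A : 'I_n -> {fset 'X_{1..n}}) (J : {set 'I_n}) :
    {fset 'X_{1..n}} :=
  \big[minkowski/[fset 0%MM]]_(j in J) A j.

Definition mnm_vec (R : realType) (a : 'X_{1..n}) : 'rV[R]_n :=
  \row_i (a i)%:R.

(* Dimension of the affine hull of B in R^n, i.e. of its direction space (0 by
   convention for the empty set). *)
Definition affine_dim (R : realType) (B : {fset 'X_{1..n}}) : nat :=
  \dim <<[seq mnm_vec R a - mnm_vec R b | a <- B, b <- B]>>%VS.

Definition in_O (R : realType) (I : {set 'I_n}) (x : 'I_n -> R[i]) : Prop :=
  forall i, x i = 0 <-> i \in I.

End Supports.

(* Main.v *)
(** Write gens for the n polynomials x_i (i in I) and f_j (j in J_I). The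
    coefficients of one monomial in each f_j can be eliminated in favour of the
    coordinates x_i (i not in I), so the functions on the variety of pairs
    (coefficients, zero in O_I) embed in a purely transcendental field with as many
    variables as there are coefficients. Hence a function that is not identically
    zero on this variety vanishes at no zero in O_I of a generic system; this applies
    to the Jacobian determinant of gens (in characteristic 0, unless a generic system
    has no zero in O_I) and to the genericity condition on the residual system below.

    At a zero zeta where gens has an invertible Jacobian, the coordinates off I are
    power series in those in I, and substituting them turns the f_j (j not in J_I)
    into a system g(x) = sum_b gamma_b(x) x^b with the supports B_j, whose
    coefficients gamma_b(x) are power series in the coordinates in I with generic
    constant terms. Over the ring of universal coefficients, consider the set of
    lowest monomials (for a graded monomial order) of the elements of the ideal. It
    does not change under any substitution gamma_b(x) with generic constant terms, so
    the local algebras of f at zeta and of a generic g at 0 have bases consisting of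
    the same monomials. The dimension count (A2) puts a power of every coordinate in
    the ideal, which makes them finite dimensional. *)
From HB Require Import structures.
Require Import Defs.
From mathcomp Require Import generic_quotient boolp zify ring.
Import Order.TTheory GRing.Theory Num.Theory.
Local Open Scope ring_scope.
Local Open Scope complex_scope.

Set Implicit Arguments.
Unset Strict Implicit.
Unset Printing Implicit Defensive.

(** * Induction on multivariate polynomials *)

Lemma mpoly_ring_ind (R : comNzRingType) (n : nat) (P : {mpoly R[n]} -> Prop) :
  (forall c, P c%:MP) -> (forall i, P 'X_i) ->
  (forall p q, P p -> P q -> P (p + q)) ->
  (forall p q, P p -> P q -> P (p * q)) -> forall p, P p.
Proof.
move=> PC PX PD PM p; rewrite (mpolyE p).
have P0 : P 0 by have := PC 0; rewrite mpolyC0.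
have P1 : P 1 by have := PC 1; rewrite mpolyC1.
apply: (big_ind P) => // m _; rewrite -mul_mpolyC; apply: (PM) => //.
rewrite mpolyXE_id; apply: (big_ind P) => // i _.
by elim: (m i) => [|k IHk]; rewrite ?expr0 // exprS; apply: PM.
Qed.

Lemma eq_rmorph_mpoly (R : comNzRingType) (n : nat) (S : nzRingType)
    (f g : {rmorphism {mpoly R[n]} -> S}) :
  (forall c, f c%:MP = g c%:MP) -> (forall i, f 'X_i = g 'X_i) -> f =1 g.
Proof.
move=> eqC eqX; apply: mpoly_ring_ind => // p q Hp Hq.
- by rewrite !rmorphD Hp Hq.
- by rewrite !rmorphM Hp Hq.
Qed.

(** * Ideals and lowest monomials *)

Section Ideals.
Variables (J : finType) (S : comNzRingType) (f : J -> S).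

Definition ideal (P : S) := exists q : J -> S, P = \sum_j q j * f j.

Lemma ideal0 : ideal 0.
Proof. by exists (fun=> 0); rewrite big1 // => j _; rewrite mul0r. Qed.

Lemma idealD P Q : ideal P -> ideal Q -> ideal (P + Q).
Proof.
move=> [p ->] [q ->]; exists (fun j => p j + q j).
by rewrite -big_split; apply: eq_bigr => j _; rewrite mulrDl.
Qed.

Lemma idealMl P Q : ideal Q -> ideal (P * Q).
Proof.
move=> [q ->]; exists (fun j => P * q j).
by rewrite mulr_sumr; apply: eq_bigr => j _; rewrite mulrA.
Qed.

Lemma idealMr P Q : ideal P -> ideal (P * Q).
Proof. by rewrite mulrC; apply: idealMl. Qed.

Lemma idealN P : ideal P -> ideal (- P).
Proof. by rewrite -mulN1r; apply: idealMl. Qed.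

Lemma idealB P Q : ideal P -> ideal Q -> ideal (P - Q).
Proof. by move=> hP /idealN; apply: idealD. Qed.

Lemma ideal_sum (I : Type) (r : seq I) (Pr : pred I) (F : I -> S) :
  (forall i, Pr i -> ideal (F i)) -> ideal (\sum_(i <- r | Pr i) F i).
Proof. by move=> h; apply: big_ind => //; [exact: ideal0 | exact: idealD]. Qed.

Lemma ideal_gen j : ideal (f j).
Proof.
exists (fun i => (i == j)%:R).
by rewrite (bigD1 j) //= eqxx mul1r big1 ?addr0 // => i /negPf->; rewrite mul0r.
Qed.

End Ideals.

Lemma ideal_sub (J J' : finType) (S : comNzRingType) (f : J -> S) (g : J' -> S) :
  (forall j, ideal g (f j)) -> forall P, ideal f P -> ideal g P.
Proof. by move=> h P [q ->]; apply: ideal_sum => j _; apply: idealMl. Qed.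

Lemma ideal_rmorph (J : finType) (S S' : comNzRingType) (h : {rmorphism S -> S'})
    (f : J -> S) P :
  ideal f P -> ideal (fun j => h (f j)) (h P).
Proof.
by move=> [q ->]; exists (fun j => h (q j)); rewrite rmorph_sum;
  apply: eq_bigr => j _; rewrite rmorphM.
Qed.

Section Initial.
Variables (R : comNzRingType) (r : nat).
Implicit Types (p q : {mpoly R[r]}) (m e : 'X_{1..r}).

Definition vanish_below e p := forall m, (m < e)%O -> p@_m = 0.

(** Monomials are compared by degree first, so [e] is the lowest monomial of [p]: the analogue for
    power series of a leading monomial. *)
Definition initial e p := p@_e != 0 /\ vanish_below e p.

Lemma vanish_belowD e p q :
  vanish_below e p -> vanish_below e q -> vanish_below e (p + q).
Proof. by move=> hp hq m lt_me; rewrite mcoeffD hp // hq // addr0. Qed.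

Lemma vanish_belowN e p : vanish_below e p -> vanish_below e (- p).
Proof. by move=> hp m lt_me; rewrite mcoeffN hp // oppr0. Qed.

Lemma vanish_below_le e e' p :
  (e' <= e)%O -> vanish_below e p -> vanish_below e' p.
Proof. by move=> le_e hp m lt_m; apply: hp; apply: lt_le_trans le_e. Qed.

(** If [k1 + k2 = e] then [k2 <= e], with equality only for [k1 = 0], so one term of the convolution
    survives. *)
Lemma mcoeffM_initial e p q : vanish_below e p -> (q * p)@_e = q@_0%MM * p@_e.
Proof.
move=> hp; have lt1 : (mdeg (0%MM : 'X_{1..r}) < (mdeg e).+1)%N.
  by rewrite mdeg0.
have lt2 : (mdeg e < (mdeg e).+1)%N by [].
rewrite mcoeffM (bigD1 (BMultinom lt1, BMultinom lt2)) /=; last by rewrite add0m.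
rewrite big1 ?addr0 // => -[k1 k2] /= /andP[/eqP def_e neq].
rewrite (hp k2) ?mulr0 //; have := lemc_addl k1 k2; rewrite -def_e le_eqVlt.
case/orP=> // /eqP k2e; case/negP: neq; rewrite xpair_eqE !bmeqP /= k2e eqxx.
by rewrite andbT -(inj_eq (@addIm _ (k2 : 'X_{1..r}))) add0m -def_e k2e.
Qed.

Lemma vanish_belowM e p q : vanish_below e p -> vanish_below e (q * p).
Proof.
move=> hp m lt_me; rewrite mcoeffM_initial ?hp ?mulr0 //.
exact: vanish_below_le (ltW lt_me) hp.
Qed.

Definition ord_ge (N : nat) p := forall m, (mdeg m < N)%N -> p@_m = 0.

Lemma ord_geD N p q : ord_ge N p -> ord_ge N q -> ord_ge N (p + q).
Proof. by move=> hp hq m lt_mN; rewrite mcoeffD hp // hq // addr0. Qed.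

Lemma ord_geN N p : ord_ge N p -> ord_ge N (- p).
Proof. by move=> hp m lt_mN; rewrite mcoeffN hp // oppr0. Qed.

Lemma ord_geMl N N' p q : ord_ge N p -> ord_ge N' q -> ord_ge (N + N')%N (p * q).
Proof.
move=> hp hq m lt_mN; rewrite mcoeffM big1 // => -[k1 k2] /= /eqP def_m.
case: (ltnP (mdeg k1) N) => [lt1|le1]; first by rewrite hp ?mul0r.
rewrite (hq k2) ?mulr0 //; have := congr1 mdeg def_m; rewrite mdegD; lia.
Qed.

Lemma ord_ge0 p : ord_ge 0 p.
Proof. by []. Qed.

Lemma ord_geM N p q : ord_ge N p -> ord_ge N (q * p).
Proof. by move=> hp; rewrite -[N]add0n; apply: ord_geMl. Qed.

Lemma ord_ge1P p : ord_ge 1 p <-> p@_0%MM = 0.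
Proof.
split=> [hp|p0 m]; first by apply: hp; rewrite mdeg0.
by rewrite ltnS leqn0 mdeg_eq0 => /eqP->.
Qed.

Lemma ord_geX N m : (N <= mdeg m)%N -> ord_ge N 'X_[m].
Proof.
move=> le_N k lt_k; rewrite mcoeffX; case: eqP => // def_m.
by move: le_N; rewrite def_m leqNgt lt_k.
Qed.

End Initial.

(** The termination argument of division from below: cancelling the lowest monomial may create many
    higher ones, but only finitely many monomials have degree below [N]. *)
Lemma initial_ind (R : comNzRingType) (r N : nat) (P : {mpoly R[r]} -> Prop) :
  (forall p, ord_ge N p -> P p) ->
  (forall p e, (mdeg e < N)%N -> initial e p ->
    (forall p', vanish_below e p' -> p'@_e = 0 -> P p') -> P p) ->
  forall p, P p.
Proof.
move=> Pbase Pstep p.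
(* Monomials of degree below [N] that dominate some monomial of [q]; cancelling the lowest term
   removes at least [e] from this set and adds nothing. *)
pose above (q : {mpoly R[r]}) := [set m : 'X_{1..r < N} |
  [exists m' : 'X_{1..r < N}, ((m' : 'X_{1..r}) <= m)%O && (q@_m' != 0)]].
have [k] := ubnP #|above p|; elim: k p => // k IHk p lt_k.
have [/existsP[m0 nz_m0]|] := boolP [exists m : 'X_{1..r < N}, p@_m != 0];
  last first.
  rewrite negb_exists => /forallP z_p; apply: Pbase => m lt_mN.
  by have := z_p (BMultinom lt_mN); rewrite negbK => /eqP.
have [e nz_e min_e] := @Order.TotalTheory.arg_minP _ _ _ m0
  (fun m : 'X_{1..r < N} => p@_m != 0) (fun m => bmnm m) nz_m0.
have init_e : initial e p.
  split=> // m lt_me; apply/eqP; apply: contraTT lt_me => nz_m.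
  have [lt_mN|le_Nm] := ltnP (mdeg m) N.
    by rewrite -leNgt; apply: (min_e (BMultinom lt_mN)).
  rewrite -leNgt; apply/ltW/lt_mdeg_ltmc/(leq_trans (bmdeg e) le_Nm).
apply: (Pstep p e) => // [|p' lt_p' p'e]; first exact: bmdeg.
apply: IHk; rewrite -ltnS; apply: leq_trans lt_k; rewrite ltnS.
apply/proper_card/properP; split; last first.
  exists e; first by rewrite inE; apply/existsP; exists e; rewrite lexx.
  rewrite inE negb_exists; apply/forallP => m'; rewrite negb_and negbK -implybE.
  by apply/implyP; rewrite le_eqVlt => /orP[/eqP->|/lt_p' ->//]; apply/eqP.
apply/subsetP => m; rewrite !inE => /existsP[m' /andP[le_m' nz_m']].
apply/existsP; exists e; rewrite nz_e andbT; apply: le_trans le_m'.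
rewrite leNgt; apply: contra nz_m' => lt_m'; apply/eqP; exact: lt_p'.
Qed.

(** * Lowest monomials under substitution of the coefficients *)

Section Substitution.
Variables (C : fieldType) (r t : nat).
Implicit Types (gam : 'I_t -> {mpoly C[r]}) (P : {mpoly {mpoly C[t]}[r]}).

Definition subst_coef gam : {mpoly C[t]} -> {mpoly C[r]} :=
  mmap (@mpolyC r C) gam.

HB.instance Definition _ gam := GRing.RMorphism.copy (subst_coef gam)
  (mmap (@mpolyC r C) gam).

Definition subst gam : {mpoly {mpoly C[t]}[r]} -> {mpoly C[r]} :=
  mmap (subst_coef gam) (fun i => 'X_i).

HB.instance Definition _ gam := GRing.RMorphism.copy (subst gam)
  (mmap (subst_coef gam) (fun i => 'X_i)).

Lemma substC gam a : subst gam a%:MP = subst_coef gam a.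
Proof. exact: mmapC. Qed.

Lemma substX gam m : subst gam 'X_[m] = 'X_[m].
Proof. by rewrite /subst mmapX mmap1_id. Qed.

Lemma subst_map gam p : subst gam (map_mpoly (@mpolyC t C) p) = p.
Proof.
move: p; apply: (@eq_rmorph_mpoly _ _ _ (subst gam \o map_mpoly (@mpolyC t C)) idfun).
- by move=> c /=; rewrite map_mpolyC substC /subst_coef mmapC.
- by move=> i /=; rewrite map_mpolyX substX.
Qed.

Lemma mcoeff0_subst_coef gam a :
  (subst_coef gam a)@_0%MM = a.@[fun k => (gam k)@_0%MM].
Proof.
move: a; apply: (@eq_rmorph_mpoly _ _ _ (mcoeff 0%MM \o subst_coef gam)
  (meval (fun k => (gam k)@_0%MM))).
- by move=> c /=; rewrite /subst_coef mmapC mcoeffC eqxx mulr1 mevalC.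
- by move=> i /=; rewrite /subst_coef mmapX mmap1U mevalXU.
Qed.

(** A term at a monomial above [e] stays above [e] after multiplication by any polynomial, and at
    [e] itself only the constant term of the new coefficient counts. *)
Lemma mcoeff_subst gam P e : vanish_below e P ->
  (subst gam P)@_e = (P@_e).@[fun k => (gam k)@_0%MM].
Proof.
move=> vP; rewrite /subst /mmap raddf_sum /=.
have van m a : (e < m)%O -> (a * 'X_[m] : {mpoly C[r]})@_e = 0.
  move=> lt_em; apply: (@vanish_belowM _ _ m) lt_em => k lt_k.
  by rewrite mcoeffX gt_eqF.
have coef_e a : (a * 'X_[e] : {mpoly C[r]})@_e = a@_0%MM.
  rewrite mcoeffM_initial ?mcoeffX ?eqxx ?mulr1 // => k lt_k.
  by rewrite mcoeffX gt_eqF.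
have [e_in|e_out] := boolP (e \in msupp P); last first.
  rewrite (memN_msupp_eq0 e_out) meval0 big_seq big1 // => m m_in.
  rewrite mmap1_id van // lt_neqAle leNgt; apply/andP; split.
    by apply: contraNneq e_out => ->.
  by apply: contraL m_in => /vP/eqP; rewrite mcoeff_eq0.
rewrite (bigD1_seq e) //= mmap1_id coef_e mcoeff0_subst_coef.
rewrite big_seq_cond big1 ?addr0 // => m /andP[m_in neq_m].
rewrite mmap1_id van // lt_neqAle leNgt eq_sym neq_m /=.
by apply: contraL m_in => /vP/eqP; rewrite mcoeff_eq0.
Qed.

Lemma vanish_below_subst gam P e : vanish_below e P -> vanish_below e (subst gam P).
Proof.
move=> vP m lt_me; rewrite mcoeff_subst ?vP ?meval0 //.
exact: vanish_below_le (ltW lt_me) vP.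
Qed.

Variables (J : finType) (g : J -> {mpoly {mpoly C[t]}[r]}).

Definition initials e := exists2 P, ideal g P & initial e P.

(* If P has initial monomial e but its substitution does not, then
   w P - (P_e - P_e(gam)) G_e, where w is the initial coefficient of G_e, has a
   larger initial monomial, and the same substitution as w P. *)
Lemma initial_subst N : exists2 Q : {mpoly C[t]}, Q != 0 &
  forall gam, Q.@[fun k => (gam k)@_0%MM] != 0 ->
  forall e, (mdeg e < N)%N ->
  (initials e <-> exists2 p, ideal (fun j => subst gam (g j)) p & initial e p).
Proof.
have exG e : exists G, ideal g G /\ vanish_below e G /\ (initials e -> G@_e != 0).
  have [[G iG [nzG vG]]|not_e] := pselect (initials e); first by exists G.
  by exists 0; split; [exact: ideal0 | split=> // m _; rewrite mcoeff0].
pose G e := projT1 (cid (exG e)).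
have GP e : ideal g (G e) /\ vanish_below e (G e) /\ (initials e -> (G e)@_e != 0).
  exact: projT2 (cid (exG e)).
pose w e := if `[<initials e>] then (G e)@_e else 1.
(* For each lowest monomial of degree below [N], [Q] contains the lowest coefficient of one chosen
   ideal element, so that [Q] being nonzero at the constant terms preserves all these monomials. *)
exists (\prod_(e : 'X_{1..r < N}) w e).
  apply/prodf_neq0 => e _; rewrite /w; case: asboolP => [|_]; last exact: oner_neq0.
  by have [_ [_]] := GP e.
move=> gam; rewrite rmorph_prod => /prodf_neq0 nz_w.
have nz_G e : (mdeg e < N)%N -> initials e ->
    ((G e)@_e).@[fun k => (gam k)@_0%MM] != 0.
  by move=> lt_e in_e; have := nz_w (BMultinom lt_e) isT; rewrite /w asboolT.
move=> e lt_e; split=> [in_e|[_ [q ->] init_q]].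
  have [iG [vG _]] := GP e; exists (subst gam (G e)).
    exact: ideal_rmorph iG.
  split; last exact: vanish_below_subst.
  by rewrite mcoeff_subst // nz_G.
pose P := \sum_j map_mpoly (@mpolyC t C) (q j) * g j.
have defP : subst gam P = \sum_j q j * subst gam (g j).
  by rewrite rmorph_sum; apply: eq_bigr => j _; rewrite rmorphM /= subst_map.
have iP : ideal g P by exists (fun j => map_mpoly (@mpolyC t C) (q j)).
move: init_q; rewrite -defP; move: P iP {defP}.
apply: (@initial_ind _ _ N) => [P ordP iP [nz _]|P e' lt_e' [nz' vP'] IH iP [nz vP]].
  case/negP: nz; rewrite mcoeff_subst ?ordP ?meval0 // => m lt_me.
  by apply: ordP; apply: leq_ltn_trans (lemc_mdeg (ltW lt_me)) lt_e.
have in_e' : initials e' by exists P.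
have [lt_ee'|lt_e'e|->//] := ltgtP e e'.
  by case/negP: nz; rewrite (vanish_below_subst gam vP') ?eqxx.
have [iG [vG _]] := GP e'.
have z_e' : (P@_e').@[fun k => (gam k)@_0%MM] = 0.
  by rewrite -mcoeff_subst // vP.
(* [D] is killed by the substitution, while its constant coefficient is [P@_e'], because that of
   [subst_coef gam (P@_e')] is zero. *)
pose D := (P@_e')%:MP - map_mpoly (@mpolyC t C) (subst_coef gam (P@_e')).
have substD : subst gam D = 0.
  rewrite rmorphB /= substC.
  by rewrite subst_map subrr.
pose P' := ((G e')@_e')%:MP * P - D * G e'.
have vP1 : vanish_below e' P'.
  by apply: vanish_belowD; [|apply: vanish_belowN]; apply: vanish_belowM.
apply: (IH P') => //.
- rewrite mcoeffB !mcoeffM_initial // mcoeffC eqxx mulr1 mcoeffB mcoeffC eqxx mulr1.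
  by rewrite mcoeff_map_mpoly /= mcoeff0_subst_coef z_e' mpolyC0 subr0 mulrC subrr.
- by apply: idealB; apply: idealMl.
- have -> : subst gam P' = subst_coef gam (G e')@_e' * subst gam P.
    by rewrite rmorphB !rmorphM /= substD mul0r subr0 substC.
  split; last exact: vanish_belowM.
  by rewrite mcoeffM_initial // mcoeff0_subst_coef mulf_neq0 ?nz_G.
Qed.

End Substitution.

(** * Standard monomials modulo a truncated ideal *)

Section Codimension.
Variables (C : fieldType) (r : nat) (J : finType) (g : J -> {mpoly C[r]}).
Variable N : nat.

(** The ideal generated by [g] and the [N]-th power of the maximal ideal of the origin. *)
Definition idealp (p : {mpoly C[r]}) :=
  exists q s, [/\ ideal g q, ord_ge N s & p = q + s].

Lemma idealpD p q : idealp p -> idealp q -> idealp (p + q).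
Proof.
move=> [p1 [p2 [ip op ->]]] [q1 [q2 [iq oq ->]]]; exists (p1 + q1), (p2 + q2).
by split; [exact: idealD | exact: ord_geD | rewrite addrACA].
Qed.

Lemma idealpM p q : idealp q -> idealp (p * q).
Proof.
move=> [q1 [q2 [iq oq ->]]]; exists (p * q1), (p * q2).
by split; [exact: idealMl | exact: ord_geM | rewrite mulrDr].
Qed.

Lemma idealpN p : idealp p -> idealp (- p).
Proof. by rewrite -mulN1r; apply: idealpM. Qed.

Lemma idealp_ideal p : ideal g p -> idealp p.
Proof. by exists p, 0; split; rewrite ?addr0 // => m _; rewrite mcoeff0. Qed.

Lemma idealp_ord p : ord_ge N p -> idealp p.
Proof. by exists 0, p; split; rewrite ?add0r //; apply: ideal0. Qed.

Variable B : pred 'X_{1..r}.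
Hypothesis BP : forall e, (mdeg e < N)%N ->
  (B e <-> exists2 p, ideal g p & initial e p).

Let d := #|[set m : 'X_{1..r < N} | ~~ B m]|.
Let b (k : 'I_d) : {mpoly C[r]} := 'X_[(enum_val k : 'X_{1..r < N})].

(** Below degree [N] the combination agrees with some [q] in the ideal; a lowest monomial of [q]
    there would be in [B], where the combination has no coefficient. *)
Lemma idealp_standard (c : 'rV[C]_d) : idealp (\sum_k c 0 k *: b k) -> c = 0.
Proof.
move=> [q [s [iq os def_qs]]].
pose p := \sum_k c 0 k *: b k.
have p_coef k : p@_(enum_val k : 'X_{1..r < N}) = c 0 k.
  rewrite raddf_sum /= (bigD1 k) //= mcoeffZ mcoeffX eqxx mulr1.
  rewrite big1 ?addr0 // => i neq_ik; rewrite mcoeffZ mcoeffX.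
  by rewrite -bmeqP (inj_eq enum_val_inj) (negPf neq_ik) mulr0.
have p_B m : (mdeg m < N)%N -> B m -> p@_m = 0.
  move=> lt_m Bm; rewrite raddf_sum /= big1 // => i _; rewrite mcoeffZ mcoeffX.
  case: eqP => [def_m|_]; rewrite ?mulr0 //.
  by have := enum_valP i; rewrite inE def_m Bm.
have p_q m : (mdeg m < N)%N -> p@_m = q@_m.
  by move=> lt_m; rewrite /p def_qs mcoeffD os // addr0.
have z_q : ord_ge N q.
  move: q iq p_q {def_qs}; apply: (@initial_ind _ _ N) => // q e lt_e init_e _ iq p_q.
  by case: (init_e) => /negP[]; rewrite -p_q // p_B //; apply/BP => //; exists q.
by apply/rowP => k; rewrite mxE -p_coef p_q ?z_q //; apply: bmdeg.
Qed.

(** Division from below: a lowest monomial in [B] is cancelled by an ideal element, one outside [B]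
    is moved into the linear combination. *)
Lemma idealp_decomp p : exists c : 'rV[C]_d, idealp (p - \sum_k c 0 k *: b k).
Proof.
move: p; apply: (@initial_ind _ _ N) => [p op|p e lt_e [nz_e vp] IH].
  by exists 0; apply: idealp_ord; rewrite big1 ?subr0 // => k _; rewrite mxE scale0r.
have [Be|nBe] := boolP (B e).
  have [q iq [nz_q vq]] := (BP lt_e).1 Be.
  pose a := p@_e / q@_e.
  have [||c hc] := IH (p - a *: q).
  - by apply: vanish_belowD => //; apply: vanish_belowN; rewrite -mul_mpolyC;
      apply: vanish_belowM.
  - rewrite mcoeffB.
    by rewrite mcoeffZ /a divfK // subrr.
  exists c; rewrite -(subrK (a *: q) p) addrAC; apply: idealpD => //.
  by apply: idealp_ideal; rewrite -mul_mpolyC; apply: idealMl.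
have eP : BMultinom lt_e \in [set m : 'X_{1..r < N} | ~~ B m] by rewrite inE.
have [||c hc] := IH (p - p@_e *: 'X_[e]).
- apply: vanish_belowD => //; apply: vanish_belowN => m lt_m.
  by rewrite mcoeffZ mcoeffX gt_eqF ?mulr0.
- by rewrite mcoeffB mcoeffZ mcoeffX eqxx mulr1 subrr.
exists (c + p@_e *: delta_mx 0 (enum_rank_in eP (BMultinom lt_e))).
suff -> : \sum_k (c + p@_e *: delta_mx 0 (enum_rank_in eP (BMultinom lt_e))) 0 k *: b k =
    \sum_k c 0 k *: b k + p@_e *: 'X_[e] by
  rewrite opprD addrA addrAC.
under eq_bigr do rewrite !mxE scalerDl.
rewrite big_split /=; congr (_ + _).
rewrite (bigD1 (enum_rank_in eP (BMultinom lt_e))) //= !eqxx mulr1.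
by rewrite /b enum_rankK_in // big1 ?addr0 // => k /negPf->; rewrite mulr0 scale0r.
Qed.

End Codimension.

(** * Localization at a point *)

Section Local.
Variables (k : idomainType) (n : nat) (J : finType) (f : J -> {mpoly k[n]}).
Variable z : 'I_n -> k.
Implicit Types P Q u : {mpoly k[n]}.

(** Membership in the ideal that [f] generates in the local ring at [z], with denominators
    cleared. *)
Definition loc P := exists2 u, u.@[z] != 0 & ideal f (u * P).

Lemma loc_ideal P : ideal f P -> loc P.
Proof. by move=> iP; exists 1; rewrite ?meval1 ?oner_neq0 ?mul1r. Qed.

Lemma locMl P Q : loc Q -> loc (P * Q).
Proof. by move=> [u nz iQ]; exists u => //; rewrite mulrCA; apply: idealMl. Qed.

Lemma locMr P Q : loc P -> loc (P * Q).
Proof. by rewrite mulrC; apply: locMl. Qed.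

Lemma locD P Q : loc P -> loc Q -> loc (P + Q).
Proof.
move=> [u nz_u iP] [v nz_v iQ]; exists (u * v); first by rewrite mevalM mulf_neq0.
rewrite mulrDr; apply: idealD; last by rewrite -mulrA; apply: idealMl.
by rewrite mulrAC; apply: idealMr.
Qed.

Lemma loc0 : loc 0.
Proof. exact/loc_ideal/ideal0. Qed.

Lemma loc_sum (I : Type) (r : seq I) (Pr : pred I) (F : I -> {mpoly k[n]}) :
  (forall i, Pr i -> loc (F i)) -> loc (\sum_(i <- r | Pr i) F i).
Proof. by move=> h; apply: big_ind => //; [exact: loc0 | exact: locD]. Qed.

Lemma loc_unit u P : u.@[z] != 0 -> loc (u * P) -> loc P.
Proof.
move=> nz_u [v nz_v iP]; exists (v * u); first by rewrite mevalM mulf_neq0.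
by rewrite -mulrA.
Qed.

(** Cramer's rule: the adjugate produces [\det M * v i], and the determinant is a unit at [z]. *)
Lemma loc_det (m : nat) (M : 'M[{mpoly k[n]}]_m) (v : 'I_m -> {mpoly k[n]}) :
  (\det M).@[z] != 0 -> (forall i, loc (\sum_j M i j * v j)) -> forall i, loc (v i).
Proof.
move=> nz_det hM i; apply: (loc_unit nz_det).
pose V := \col_j v j.
have -> : \det M * v i = \sum_j (\adj M) i j * \sum_l M j l * v l.
  transitivity ((\adj M *m M *m V) i 0).
    by rewrite mul_adj_mx mul_scalar_mx !mxE.
  rewrite -mulmxA mxE; apply: eq_bigr => j _; congr (_ * _).
  by rewrite mxE; apply: eq_bigr => l _; rewrite mxE.
by apply: loc_sum => j _; apply: locMl.
Qed.

(** Nakayama's lemma by the determinant trick: the matrix with the [u i] on the diagonal, minus [a],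
    is diagonal and invertible at [z]. *)
Lemma loc_nakayama (I : finType) (v : I -> {mpoly k[n]}) :
  (forall i, exists u (a : I -> {mpoly k[n]}), [/\ u.@[z] != 0,
     forall j, (a j).@[z] = 0 & loc (u * v i - \sum_j a j * v j)]) ->
  forall i, loc (v i).
Proof.
move=> h i; have /choice[u /choice[a hua]] := h.
pose M := \matrix_(s < #|I|, t < #|I|)
  (u (enum_val s) *+ (s == t) - a (enum_val s) (enum_val t)).
have <- := enum_rankK i; move: (enum_rank i).
apply: (@loc_det _ M (fun s => v (enum_val s))).
  have -> : (\det M).@[z] = \det (map_mx (meval z) M) by rewrite det_map_mx.
  have -> : map_mx (meval z) M = diag_mx (\row_s (u (enum_val s)).@[z]).
    apply/matrixP => s t; rewrite !mxE mevalB mevalMn.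
    by have [_ -> _] := hua (enum_val s); rewrite subr0.
  rewrite det_diag; apply/prodf_neq0 => s _; rewrite mxE.
  by have [] := hua (enum_val s).
move=> s; have [_ _] := hua (enum_val s); congr (loc _).
under [RHS]eq_bigr do rewrite mxE mulrBl.
rewrite sumrB; congr (_ - _); last by rewrite big_enum_val.
rewrite (bigD1 s) //= eqxx mulr1n big1 ?addr0 // => t /negPf.
by rewrite eq_sym => ->; rewrite mulr0n mul0r.
Qed.

Definition rad P := exists M, loc (P ^+ M).

Lemma rad_loc P : loc P -> rad P.
Proof. by exists 1%N; rewrite expr1. Qed.

Lemma radMl P Q : rad Q -> rad (P * Q).
Proof. by move=> [M hM]; exists M; rewrite exprMn; apply: locMl. Qed.

Lemma radD P Q : rad P -> rad Q -> rad (P + Q).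
Proof.
move=> [M hM] [M' hM']; exists (M + M')%N; rewrite exprDn.
apply: loc_sum => i _; rewrite -mulr_natl; apply: locMl.
have [le_iM'|lt_M'i] := leqP i M'.
  have le_M : (M <= M + M' - i)%N by lia.
  by rewrite -(subnK le_M) exprD -mulrA; apply: locMl; apply: locMr.
by rewrite -(subnK (ltnW lt_M'i)) exprD mulrA; apply: locMl.
Qed.

Lemma rad_sum (I : Type) (r : seq I) (Pr : pred I) (F : I -> {mpoly k[n]}) :
  (forall i, Pr i -> rad (F i)) -> rad (\sum_(i <- r | Pr i) F i).
Proof. by move=> h; apply: big_ind => //; [exact: rad_loc loc0 | exact: radD]. Qed.

Lemma rad_unit u P : u.@[z] != 0 -> rad (u * P) -> rad P.
Proof.
move=> nz_u [M]; rewrite exprMn => hM; exists M; apply: loc_unit hM.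
by rewrite rmorphXn expf_neq0.
Qed.

Lemma rad_exp P M : rad (P ^+ M) -> rad P.
Proof. by move=> [M']; rewrite -exprM; exists (M * M')%N. Qed.

End Local.

Lemma loc_trans (k : idomainType) (n : nat) (J J' : finType)
    (f : J -> {mpoly k[n]}) (g : J' -> {mpoly k[n]}) z :
  (forall j, loc g z (f j)) -> forall P, loc f z P -> loc g z P.
Proof.
move=> h P [u nz_u [q defP]]; apply: (loc_unit nz_u); rewrite defP.
by apply: loc_sum => j _; apply: locMl.
Qed.

Section OriginMultiplicity.
Variables (k : idomainType) (n : nat) (J : finType) (f : J -> {mpoly k[n]}).

(* The zero locus is stratified by the set L of vanishing coordinates; on each
   stratum but the origin, a unit times a monomial in the nonvanishing
   coordinates is in the ideal. *)
Lemma origin_radical :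
  (forall L : {set 'I_n}, L != setT -> exists K u (v : 'I_n -> {mpoly k[n]}),
     u.@[fun=> 0] != 0 /\
     loc f (fun=> 0) (u * (\prod_(i in ~: L) 'X_i) ^+ K - \sum_(l in L) 'X_l * v l)) ->
  forall i, rad f (fun=> 0) 'X_i.
Proof.
move=> h; pose X (L : {set 'I_n}) : {mpoly k[n]} := \prod_(i in ~: L) 'X_i.
suff radX L : L != setT -> rad f (fun=> 0) (X L).
  move=> i; have -> : 'X_i = X (~: [set i]) by rewrite /X setCK big_set1.
  apply: radX; apply/eqP => /setP/(_ i); by rewrite !inE eqxx.
have [m] := ubnP #|L|; elim: m L => // m IHm L; rewrite ltnS => le_m neqL.
have [K [u [v [nz_u hL]]]] := h L neqL.
apply: (@rad_exp _ _ _ _ _ _ K.+1); apply: (rad_unit nz_u).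
(* The extra factor [X L] turns each ['X_l] of the remainder into [X (L :\ l)], which is in the
   radical by induction on the size of [L]. *)
have -> : u * X L ^+ K.+1 =
   X L * (u * X L ^+ K - \sum_(l in L) 'X_l * v l) + \sum_(l in L) v l * ('X_l * X L).
  rewrite mulrBr mulr_sumr exprS mulrCA -addrA addrC -[LHS]add0r; congr (_ + _).
  apply/eqP; rewrite eq_sym addrC subr_eq0; apply/eqP/eq_bigr => l _.
  by ring.
apply: radD; first by apply/radMl/rad_loc.
apply: rad_sum => l lL; apply: radMl.
have -> : 'X_l * X L = X (L :\ l).
  rewrite /X (big_setD1 l (A := ~: (L :\ l))) ?inE ?eqxx //=; congr (_ * _).
  apply: eq_bigl => i; rewrite !inE negb_and negbK.
  by case: eqP => [->|]; rewrite ?lL.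
apply: IHm; first by apply: leq_trans le_m; rewrite [leqRHS](cardsD1 l) lL.
by apply/eqP => /setP/(_ l); rewrite !inE eqxx.
Qed.

Lemma origin_monomials : (forall i, rad f (fun=> 0) 'X_i) ->
  exists K, forall m, (K <= mdeg m)%N -> loc f (fun=> 0) 'X_[m].
Proof.
move=> /choice[M hM]; exists (\sum_i M i).+1 => m lt_m.
have [i lt_i] : exists i, (M i < m i)%N.
  apply/existsP; apply: contraLR lt_m; rewrite negb_exists -leqNgt => /forallP h.
  by rewrite mdegE; apply: leq_sum => i _; rewrite leqNgt.
rewrite mpolyXE_id (bigD1 i) //=; apply: locMr.
by rewrite -(subnK (ltnW lt_i)) exprD; apply: locMl.
Qed.

End OriginMultiplicity.

(** The inverse is a geometric series in [h = 1 - p / p(0)], cut after [N] terms; [h] has no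
    constant term. *)
Lemma unit_mod (C : fieldType) (r N : nat) (p : {mpoly C[r]}) :
  p@_0%MM != 0 -> exists s, ord_ge N (p * s - 1).
Proof.
move=> nz; pose h := 1 - (p@_0%MM)^-1 *: p.
exists ((p@_0%MM)^-1 *: \sum_(i < N) h ^+ i).
have -> : p * ((p@_0%MM)^-1 *: \sum_(i < N) h ^+ i) - 1 = - h ^+ N.
  have -> : p * ((p@_0%MM)^-1 *: \sum_(i < N) h ^+ i) = (1 - h) * \sum_(i < N) h ^+ i.
    have -> : 1 - h = (p@_0%MM)^-1 *: p by rewrite /h opprB addrC subrK.
    by rewrite -scalerAl -scalerAr.
  have -> : 1 - h = - (h - 1) by rewrite [RHS]opprB.
  by rewrite mulNr -subrX1 opprB addrAC subrr add0r.
apply: ord_geN; elim: N => [|N IHN]; first exact: ord_ge0.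
rewrite exprS -add1n; apply: ord_geMl => //; apply/ord_ge1P.
by rewrite mcoeffB mcoeff1 eqxx mcoeffZ mulVf // subrr.
Qed.

Section LocalRing.
Variables (R : realType) (n : nat) (K : finType) (f : K -> {mpoly R[i][n]}).
Variable z : 'I_n -> R[i].
Local Notation Fr := {fraction {mpoly R[i][n]}}.

Lemma local_ringD (u v : Fr) : local_ring z u -> local_ring z v ->
  local_ring z (u + v).
Proof.
move=> [p [q [nz_q ->]]] [p' [q' [nz_q' ->]]]; exists (p * q' + p' * q), (q * q').
split; first by rewrite mevalM mulf_neq0.
have nz0 a : a.@[z] != 0 -> tofrac a != 0 :> Fr.
  by apply: contraNneq => /eqP; rewrite tofrac_eq0 => /eqP->; rewrite meval0.
by rewrite addf_div ?nz0 // !tofracD !tofracM.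
Qed.

Lemma local_ringM (u v : Fr) : local_ring z u -> local_ring z v ->
  local_ring z (u * v).
Proof.
move=> [p [q [nz_q ->]]] [p' [q' [nz_q' ->]]]; exists (p * p'), (q * q').
split; first by rewrite mevalM mulf_neq0.
by rewrite mulf_div !tofracM.
Qed.

Lemma local_ring_poly p : local_ring z (tofrac p).
Proof.
by exists p, 1; rewrite meval1 oner_neq0 tofrac1 divr1.
Qed.

Lemma local_ideal_add u v :
  local_ideal f z u -> local_ideal f z v -> local_ideal f z (u + v).
Proof.
move=> [h [hh ->]] [h' [hh' ->]]; exists (fun j => h j + h' j); split.
  by move=> j; apply: local_ringD.
by rewrite -big_split; apply: eq_bigr => j _; rewrite mulrDl.
Qed.

Lemma local_ideal_mul u v :
  local_ring z u -> local_ideal f z v -> local_ideal f z (u * v).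
Proof.
move=> hu [h [hh ->]]; exists (fun j => u * h j); split.
  by move=> j; apply: local_ringM.
by rewrite mulr_sumr; apply: eq_bigr => j _; rewrite mulrA.
Qed.

Lemma local_idealP P : local_ideal f z (tofrac P) <-> loc f z P.
Proof.
have nz0 a : a.@[z] != 0 -> tofrac a != 0 :> Fr.
  by apply: contraNneq => /eqP; rewrite tofrac_eq0 => /eqP->; rewrite meval0.
split=> [[h [/choice[p /choice[q hpq]]]]|[u nz_u [q defP]]]; last first.
  exists (fun j => tofrac (q j) / tofrac u); split=> [j|].
    by exists (q j), u.
  apply: (mulfI (nz0 u nz_u)); rewrite -tofracM defP mulr_sumr rmorph_sum /=.
  by apply: eq_bigr => j _; rewrite tofracM [RHS]mulrCA [RHS]mulrA divfK ?nz0.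
move=> defP; exists (\prod_j q j).
  by rewrite rmorph_prod; apply/prodf_neq0 => j _; have [] := hpq j.
exists (fun j => (\prod_(l | l != j) q l) * p j); apply/eqP.
rewrite -tofrac_eq tofracM defP mulr_sumr rmorph_sum; apply/eqP/eq_bigr => j _ /=.
have [nz ->] := hpq j; rewrite !tofracM (bigD1 j) //= tofracM mulrA; congr (_ * _).
by rewrite [LHS]mulrC mulrA divfK ?nz0 // mulrC.
Qed.

(** [psi] plays the role of a truncated expansion at [z]. It pulls the ideal [idealp g N] back to
    the local ideal, so lifts of the standard monomials form a basis of the local algebra. *)
Lemma has_multiplicity_quotient (r N : nat) (J : finType)
    (psi : {rmorphism {mpoly R[i][n]} -> {mpoly R[i][r]}})
    (iota : {mpoly R[i][r]} -> {mpoly R[i][n]}) (g : J -> {mpoly R[i][r]})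
    (B : pred 'X_{1..r}) :
  (forall c, psi c%:MP = c%:MP) -> (forall p, psi (iota p) = p) ->
  (forall P, (psi P)@_0%MM = P.@[z]) ->
  (forall P, idealp g N (psi P) <-> loc f z P) ->
  (forall e, (mdeg e < N)%N -> (B e <-> exists2 p, ideal g p & initial e p)) ->
  has_multiplicity f z #|[set m : 'X_{1..r < N} | ~~ B m]|.
Proof.
move=> psiC iotaK psi0 locP BP.
pose b (k : 'I_#|[set m : 'X_{1..r < N} | ~~ B m]|) :=
  iota 'X_[(enum_val k : 'X_{1..r < N})].
exists (fun k => tofrac (b k)); split=> [k|u]; first exact: local_ring_poly.
have comb (P : {mpoly R[i][n]}) (c : 'rV[R[i]]_#|[set m : 'X_{1..r < N} | ~~ B m]|) :
    tofrac P - \sum_k tofrac (c 0 k)%:MP * tofrac (b k) =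
    tofrac (P - \sum_k (c 0 k)%:MP * b k) :> Fr.
  rewrite tofracB rmorph_sum; congr (_ - _).
  by apply: eq_bigr => k _; rewrite -tofracM.
have psi_comb (c : 'rV[R[i]]_#|[set m : 'X_{1..r < N} | ~~ B m]|) :
    psi (\sum_k (c 0 k)%:MP * b k) =
    \sum_k c 0 k *: 'X_[(enum_val k : 'X_{1..r < N})].
  by rewrite rmorph_sum; apply: eq_bigr => k _; rewrite rmorphM /= psiC iotaK mul_mpolyC.
move=> [p [q [nz_q ->]]].
(* Denominators can be removed: an inverse of [psi q] up to order [N] lifts to an inverse of [q]
   modulo the local ideal. *)
have [s hs] : exists s, loc f z (q * s - 1).
  have [|s hs] := @unit_mod _ _ N (psi q); first by rewrite psi0.
  exists (iota s); apply/locP; rewrite rmorphB rmorphM rmorph1 /= iotaK.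
  exact: idealp_ord.
have nz_fq : tofrac q != 0 :> Fr.
  by apply: contraNneq nz_q => /eqP; rewrite tofrac_eq0 => /eqP->; rewrite meval0.
have hps : local_ideal f z (tofrac p / tofrac q - tofrac (p * s)).
  have -> : tofrac p / tofrac q - tofrac (p * s) =
      - (tofrac p / tofrac q) * tofrac (q * s - 1).
    rewrite tofracB !tofracM tofrac1 mulNr mulrBr mulr1 opprB; congr (_ - _).
    by rewrite mulrA divfK.
  apply: local_ideal_mul; last exact/local_idealP.
  by exists (- p), q; split=> //; rewrite tofracN mulNr.
have equiv (c : 'rV[R[i]]_#|[set m : 'X_{1..r < N} | ~~ B m]|) :
    local_ideal f z (tofrac p / tofrac q -
      \sum_k tofrac (c 0 k)%:MP * tofrac (b k)) <->
    idealp g N (psi (p * s) - \sum_k c 0 k *: 'X_[(enum_val k : 'X_{1..r < N})]).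
  rewrite -psi_comb -rmorphB; apply: iff_trans (iff_sym (locP _)).
  rewrite -local_idealP -comb; split=> h.
    have -> : tofrac (p * s) - \sum_k tofrac (c 0 k)%:MP * tofrac (b k) =
      (tofrac p / tofrac q - \sum_k tofrac (c 0 k)%:MP * tofrac (b k)) +
      tofrac (- 1) * (tofrac p / tofrac q - tofrac (p * s)) by rewrite tofracN tofrac1; ring.
    apply: local_ideal_add => //; apply: local_ideal_mul => //; exact: local_ring_poly.
  by rewrite -(subrKA (tofrac (p * s))); apply: local_ideal_add.
have [c hc] := idealp_decomp BP (psi (p * s)).
exists c; split=> [|c' hc']; first exact/equiv.
apply/eqP; rewrite -subr_eq0; apply/eqP/(idealp_standard BP).
have := idealpD ((equiv c').1 hc') (idealpN hc); congr (idealp _ _ _).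
rewrite opprB addrC subrKA -sumrB; apply: eq_bigr => k _.
by rewrite !mxE -scalerBl.
Qed.

End LocalRing.

(** * Algebraic dependence *)

Section Fractions.
Import FracField.
Local Open Scope quotient_scope.

Lemma fractionP (D : idomainType) (x : {fraction D}) :
  exists p : D * D, p.2 != 0 /\ x = tofrac p.1 / tofrac p.2.
Proof.
elim/quotW: x => x; exists (\n_x, \d_x); split; first exact: denom_ratioP.
have nz : tofrac \d_x != 0 by rewrite tofrac_eq0 denom_ratioP.
apply: (mulIf nz); rewrite divfK //=; unlock tofrac.
rewrite - [LHS]pi_mul.
apply/eqmodP; rewrite /= equivfE /mulf /=.
by rewrite !numden_Ratio ?mulf_neq0 ?denom_ratioP ?oner_neq0 // !mulr1 mulrC.
Qed.

End Fractions.

Lemma tofrac_expM (D : idomainType) (p q : D) k E : q != 0 -> (k <= E)%N ->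
  tofrac (q ^+ E) * (tofrac p / tofrac q) ^+ k = tofrac (p ^+ k * q ^+ (E - k)).
Proof.
move=> nz_q le_k; rewrite -{1}(subnK le_k) exprD !tofracM expr_div_n.
rewrite !tofracXn -mulrA [_ ^+ k * _]mulrC divfK 1?mulrC //.
by rewrite expf_neq0 // tofrac_eq0.
Qed.

Section Degree.
Variables (R : comNzRingType) (n : nat).
Implicit Types p q : {mpoly R[n]}.

Definition deg_le d p := forall m, (d < mdeg m)%N -> p@_m = 0.

Lemma deg_leM d d' p q : deg_le d p -> deg_le d' q -> deg_le (d + d')%N (p * q).
Proof.
move=> hp hq m lt_m; rewrite mcoeffM big1 // => -[k1 k2] /= /eqP def_m.
case: (ltnP d (mdeg k1)) => [lt1|le1]; first by rewrite hp ?mul0r.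
rewrite (hq k2) ?mulr0 //; have := congr1 mdeg def_m; rewrite mdegD; lia.
Qed.

Lemma deg_le1 : deg_le 0 1.
Proof. by move=> m; rewrite mcoeff1 lt0n mdeg_eq0 => /negPf->. Qed.

Lemma deg_leX d p k : deg_le d p -> deg_le (d * k)%N (p ^+ k).
Proof.
move=> hp; elim: k => [|k IHk]; first by rewrite muln0; apply: deg_le1.
by rewrite exprS mulnS; apply: deg_leM.
Qed.

Lemma deg_le_le d d' p : (d <= d')%N -> deg_le d p -> deg_le d' p.
Proof. by move=> le_d hp m lt_m; apply: hp; apply: leq_ltn_trans lt_m. Qed.

Lemma deg_le_prod (I : finType) (d : I -> nat) (F : I -> {mpoly R[n]}) :
  (forall i, deg_le (d i) (F i)) -> deg_le (\sum_i d i)%N (\prod_i F i).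
Proof.
move=> h; elim/big_rec2: _ => [|i d' p _]; first exact: deg_le1.
exact: deg_leM.
Qed.

Lemma deg_le_msize p : deg_le (msize p) p.
Proof. by move=> m lt_m; apply/memN_msupp_eq0/msize_mdeg_ge/ltnW. Qed.

End Degree.

Lemma card_bmultinom n d : (#|{: 'X_{1..n < d}}| <= d ^ n)%N.
Proof.
have lt_d (m : 'X_{1..n < d}) i : ((m : 'X_{1..n}) i < d)%N.
  apply: leq_ltn_trans (bmdeg m); rewrite mdegE (bigD1 i) //=; exact: leq_addr.
pose h m := [ffun i => Ordinal (lt_d m i)].
have /leq_card : injective h.
  move=> m m' /ffunP eq_h; apply/val_inj/mnmP => i.
  by have := eq_h i; rewrite !ffunE => /(congr1 val).
by rewrite card_ffun !card_ord.
Qed.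

Lemma row_kernel (C : fieldType) (I X : finType) (M : I -> X -> C) :
  (#|X| < #|I|)%N ->
  exists2 lam : I -> C, (exists i, lam i != 0) & forall x, \sum_i lam i * M i x = 0.
Proof.
move=> lt_XI; pose A := \matrix_(i < #|I|, x < #|X|) M (enum_val i) (enum_val x).
have /rowV0Pn[v /sub_kermxP vA nz_v] : kermx A != 0.
  rewrite kermx_eq0 /row_free neq_ltn.
  by rewrite (leq_ltn_trans (rank_leq_col A)).
exists (fun i => v 0 (enum_rank i)).
  have /rV0Pn[i nz_i] := nz_v; exists (enum_val i); by rewrite enum_valK.
move=> x; have /rowP/(_ (enum_rank x)) := vA; rewrite !mxE => sum0.
rewrite -[RHS]sum0 [LHS]big_enum_val /=; apply: eq_bigr => i _.
by rewrite mxE enum_valK enum_rankK.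
Qed.

(* The products of powers less than E of the N + 1 elements number E ^ N.+1, and
   over a common denominator they have numerators in a space of dimension
   O(E ^ N). *)
Lemma algebraic_dependence (C : fieldType) (N : nat)
    (h : {rmorphism {mpoly C[N]} -> {fraction {mpoly C[N]}}})
    (v : {fraction {mpoly C[N]}}) :
  (forall c, h c%:MP = tofrac c%:MP) ->
  exists2 F : {poly {mpoly C[N]}}, F != 0 & (map_poly h F).[v] = 0.
Proof.
move=> hC; pose u i := h 'X_i.
have [[P0 q0] [/= nz_q0 def_v]] := fractionP v.
have /choice[Pq hPq] : forall i, exists p : _ * _, p.2 != 0 /\ u i = tofrac p.1 / tofrac p.2.
  by move=> i; apply: fractionP.
pose d := (msize P0 + msize q0 + \sum_i (msize (Pq i).1 + msize (Pq i).2))%N.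
have d0 : deg_le d P0 /\ deg_le d q0.
  by split; [apply: deg_le_le (@deg_le_msize _ _ P0) | apply: deg_le_le (@deg_le_msize _ _ q0)];
    rewrite /d -addnA ?leq_addr // addnCA leq_addr.
have di i : deg_le d (Pq i).1 /\ deg_le d (Pq i).2.
  have le_i : (msize (Pq i).1 + msize (Pq i).2 <= d)%N.
    by rewrite /d (bigD1 i) //= addnCA leq_addr.
  by split; [apply: deg_le_le (@deg_le_msize _ _ (Pq i).1)
            | apply: deg_le_le (@deg_le_msize _ _ (Pq i).2)];
    apply: leq_trans le_i; rewrite ?leq_addr ?leq_addl.
have [D defD] : {D | D = (d + \sum_(i < N) d)%N} by eexists.
(* With this [E] the [E ^ N.+1] products outnumber the monomials of degree at most [D * E], of which
   there are at most [(D.+1 * E) ^ N]. *)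
have [E E_gt0 ltE] : exists2 E, (0 < E)%N & (D.+1 ^ N < E)%N by exists (D.+1 ^ N).+1.
pose M (e : 'I_E * {ffun 'I_N -> 'I_E}) := P0 ^+ e.1 * q0 ^+ (E - e.1) *
  \prod_i ((Pq i).1 ^+ (e.2 i) * (Pq i).2 ^+ (E - e.2 i)).
have degM e : deg_le (D * E) (M e).
  have deg1 p q k : deg_le d p /\ deg_le d q -> (k < E)%N ->
      deg_le (d * E)%N (p ^+ k * q ^+ (E - k)).
    move=> [dp dq] lt_k; rewrite -{1}(subnKC (ltnW lt_k)) mulnDr.
    by apply: deg_leM; apply: deg_leX.
  rewrite defD mulnDl big_distrl /=; apply: deg_leM; first exact: deg1.
  by apply: deg_le_prod => i; apply: deg1.
have [|lam [e0 nz_lam] sum_lam] := @row_kernel _ _ _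
    (fun e (m : 'X_{1..N < (D * E).+1}) => (M e)@_m).
  rewrite card_prod card_ffun !card_ord; apply: leq_ltn_trans (card_bmultinom _ _) _.
  have le1 : (((D * E).+1) ^ N <= (D.+1 * E) ^ N)%N.
    have le_base : ((D * E).+1 <= D.+1 * E)%N by rewrite mulSn addnC -addn1 leq_add2l.
    by case: (N) => // N'; rewrite leq_exp2r.
  apply: leq_ltn_trans le1 _; by rewrite expnMn ltn_pmul2r // expn_gt0 E_gt0 //.
have sumM : \sum_e lam e *: M e = 0.
  apply/mpolyP => m; rewrite mcoeff0 raddf_sum /=.
  have [lt_m|le_m] := ltnP (mdeg m) (D * E).+1.
    by rewrite -[RHS](sum_lam (BMultinom lt_m)); apply: eq_bigr => e _; rewrite mcoeffZ.
  by rewrite big1 // => e _; rewrite mcoeffZ degM ?mulr0.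
pose mon (e : {ffun 'I_N -> 'I_E}) := [multinom (e i : nat) | i < N].
(* Distinct exponents give distinct terms, so [F] is nonzero over [{mpoly C[N]}], even where [h] has
   a kernel. *)
exists (\sum_e (lam e *: 'X_[mon e.2])%:P * 'X^(e.1)).
  apply: contraNneq nz_lam => F0; have := congr1 (fun F : {poly _} => F`_(e0.1)@_(mon e0.2)) F0.
  rewrite coef0 mcoeff0 coef_sum raddf_sum /= (bigD1 e0) //= coefCM coefXn eqxx mulr1.
  rewrite mcoeffZ mcoeffX eqxx mulr1 big1 ?addr0 => [->|e neq_e] //.
  rewrite coefCM coefXn; case: eqP => [eq1|_]; last by rewrite mulr0 mcoeff0.
  rewrite mulr1 mcoeffZ mcoeffX; case: eqP => [eq2|_]; last by rewrite mulr0.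
  case/eqP: neq_e; move: eq1 eq2; case: e e0 => [e1 e2] [e1' e2'] /= eq1 /mnmP eq2.
  congr (_, _); first exact: val_inj.
  by apply/ffunP => i; apply: val_inj; have := eq2 i; rewrite !mnmE.
pose den := tofrac (q0 ^+ E * \prod_i (Pq i).2 ^+ E).
have nz_den : den != 0.
  rewrite tofrac_eq0 mulf_neq0 ?expf_neq0 //; apply/prodf_neq0 => i _.
  by rewrite expf_neq0 //; have [] := hPq i.
apply: (mulfI nz_den); rewrite mulr0 -(tofrac0 {mpoly C[N]}) -sumM rmorph_sum /=.
rewrite rmorph_sum horner_sum mulr_sumr /=; apply: eq_bigr => x _.
rewrite rmorphM /= map_polyC map_polyXn hornerCM hornerXn /=.
have -> : h (lam x *: 'X_[mon x.2]) = tofrac (lam x)%:MP *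
    \prod_i (tofrac (Pq i).1 / tofrac (Pq i).2) ^+ (x.2 i).
  rewrite -mul_mpolyC rmorphM hC mpolyXE_id rmorph_prod; congr (_ * _).
  by apply: eq_bigr => i _; rewrite rmorphXn mnmE; have [_ <-] := hPq i.
rewrite -mul_mpolyC [RHS]tofracM mulrCA -mulrA; congr (_ * _).
transitivity (tofrac (q0 ^+ E) * v ^+ x.1 * \prod_i
  (tofrac ((Pq i).2 ^+ E) * (tofrac (Pq i).1 / tofrac (Pq i).2) ^+ (x.2 i))).
  by rewrite big_split /= /den tofracM rmorph_prod /= mulrC mulrACA mulrA mulrAC.
rewrite def_v tofrac_expM //; last exact: ltnW.
rewrite /M [RHS]tofracM rmorph_prod /=; congr (_ * _); apply: eq_bigr => i _.
by have [nz_q _] := hPq i; rewrite tofrac_expM // ltnW.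
Qed.

(** * Elimination on a coordinate stratum *)

Lemma cross_addB (S : comNzRingType) (x1 x2 p1 p2 q1 q2 : S) :
  x1 * x2 * (p1 + p2) - (x2 * q1 + x1 * q2) =
  x2 * (x1 * p1 - q1) + x1 * (x2 * p2 - q2).
Proof. by ring. Qed.

Lemma cross_mulB (S : comNzRingType) (x1 x2 p1 p2 q1 q2 : S) :
  x1 * x2 * (p1 * p2) - q1 * q2 = x2 * p2 * (x1 * p1 - q1) + q1 * (x2 * p2 - q2).
Proof. by ring. Qed.

Section Universal.
Variables (C : fieldType) (n : nat) (K : finType) (A : K -> {fset 'X_{1..n}}).
Local Notation T := {j : K & A j}.
Local Notation Co := {mpoly C[#|{: T}|]}.
Local Notation tag_of a := (Tagged (fun j => A j) a).

Definition mnm_of (t : T) : 'X_{1..n} := val (tagged t).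

Definition univ (j : K) : {mpoly Co[n]} :=
  \sum_(a : A j) 'X_(enum_rank (tag_of a)) *: 'X_[val a].

(* On the stratum where exactly the variables in L vanish, the coefficient of
   index [y i] of the equation [tag (y i)] can be eliminated, for each i not in
   L. Its place is then taken by the variable x_i: this identifies the functions
   on the incidence variety of the stratum with rational functions in as many
   variables as there are coefficients. *)
Variables (L : {set 'I_n}) (y : 'I_n -> T).
Hypothesis y_off : forall i l, i \notin L -> l \in L -> mnm_of (y i) l = 0%N.
Hypothesis y_inj : forall i i', i \notin L -> i' \notin L ->
  tag (y i) = tag (y i') -> i = i'.

Definition gens (i : 'I_n) : {mpoly Co[n]} :=
  if i \in L then 'X_i else univ (tag (y i)).

Definition slot (t : T) : option 'I_n := [pick i | (i \notin L) && (y i == t)].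

Definition coord (i : 'I_n) : Co := if i \in L then 0 else 'X_(enum_rank (y i)).

Definition rest (i : 'I_n) : Co :=
  \sum_(a : A (tag (y i)) | tag_of a != y i)
    'X_(enum_rank (tag_of a)) * mmap1 coord (val a).

Local Notation Fr := {fraction Co}.

Definition elim_coef : {rmorphism Co -> Fr} := mmap (@tofrac _ \o @mpolyC #|{: T}| C)
  (fun k => if slot (enum_val k) is Some i
            then - tofrac (rest i) / tofrac (mmap1 coord (mnm_of (y i)))
            else tofrac 'X_k).

Definition elim : {rmorphism {mpoly Co[n]} -> Fr} := mmap elim_coef (fun i => tofrac (coord i)).

(** A section of [elim]: the variable freed by the elimination for [i] is read as ['X_i], every
    other variable as the coefficient it is. *)
Definition relabel : {rmorphism Co -> {mpoly Co[n]}} :=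
  mmap (@mpolyC n Co \o @mpolyC #|{: T}| C)
    (fun k => if slot (enum_val k) is Some i then 'X_i else ('X_k)%:MP).

Lemma elim_coefC c : elim_coef c%:MP = tofrac c%:MP.
Proof. exact: mmapC. Qed.

Lemma elim_coefX k : elim_coef 'X_k =
  if slot (enum_val k) is Some i
  then - tofrac (rest i) / tofrac (mmap1 coord (mnm_of (y i))) else tofrac 'X_k.
Proof. by rewrite [LHS]mmapX mmap1U. Qed.

Lemma elimC a : elim a%:MP = elim_coef a.
Proof. exact: mmapC. Qed.

Lemma elimXU i : elim 'X_i = tofrac (coord i).
Proof. by rewrite [LHS]mmapX mmap1U. Qed.

Lemma relabelC c : relabel c%:MP = c%:MP%:MP.
Proof. exact: mmapC. Qed.

Lemma relabelX k : relabel 'X_k =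
  if slot (enum_val k) is Some i then 'X_i else ('X_k)%:MP.
Proof. by rewrite [LHS]mmapX mmap1U. Qed.

Opaque elim_coef elim relabel.

Lemma eq_tag_of (t : T) (a : A (tag t)) : (tag_of a == t) = (a == tagged t).
Proof. by case: t a => j b a; rewrite eq_Tagged. Qed.

Lemma slotP t : (exists i, [/\ i \notin L, y i = t & slot t = Some i]) \/
  ((forall i, i \notin L -> y i != t) /\ slot t = None).
Proof.
rewrite /slot; case: pickP => [i /andP[iL /eqP yi]|none]; [left|right].
  by exists i.
by split=> // i iL; have := none i; rewrite iL => /negbT.
Qed.

Lemma slot_y i : i \notin L -> slot (y i) = Some i.
Proof.
move=> iL; have [[i' [i'L eq_y ->]]|[/(_ i iL)]] := slotP (y i); last by rewrite eqxx.
by rewrite (y_inj i'L iL) // eq_y.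
Qed.

Lemma slot_rest i a : i \notin L -> tag_of a != y i ->
  slot (tag_of (a : A (tag (y i)))) = None.
Proof.
move=> iL neq; have [[i' [i'L eq_y _]]|[_ ->]//] := slotP (tag_of a).
have eq_i : i' = i by apply: y_inj => //; rewrite eq_y.
by rewrite -eq_y eq_i eqxx in neq.
Qed.

Lemma elim_relabel P : elim (relabel P) = tofrac P.
Proof.
move: P; apply: (@eq_rmorph_mpoly _ _ _ (elim \o relabel) (@tofrac _)) => [c|k] /=.
  by rewrite relabelC elimC elim_coefC.
rewrite relabelX.
have [[i [iL yi ->]]|[_ def_slot]] := slotP (enum_val k).
  by rewrite elimXU /coord (negPf iL) yi enum_valK.
by rewrite def_slot elimC elim_coefX def_slot.
Qed.

Lemma coord_off (m : 'X_{1..n}) : (forall l, l \in L -> m l = 0%N) -> mmap1 coord m != 0.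
Proof.
move=> m_off; apply/prodf_neq0 => i _; rewrite /coord.
case: ifP => [/m_off->|_]; first by rewrite expr0 oner_neq0.
by rewrite expf_neq0 // -msize_poly_eq0 msizeX.
Qed.

Lemma coord_on (m : 'X_{1..n}) l : l \in L -> m l != 0%N -> mmap1 coord m = 0.
Proof.
by move=> lL nz; rewrite /mmap1 (bigD1 l) //= /coord lL expr0n (negPf nz) mul0r.
Qed.

Lemma elim_X m : elim 'X_[m] = tofrac (mmap1 coord m).
Proof.
rewrite [LHS]mmapX /mmap1 rmorph_prod /=.
by apply: eq_bigr => i _; rewrite tofracXn.
Qed.

Lemma relabel_coord (m : 'X_{1..n}) : (forall l, l \in L -> m l = 0%N) ->
  relabel (mmap1 coord m) = 'X_[m].
Proof.
move=> m_off; rewrite mpolyXE_id /mmap1 rmorph_prod /=; apply: eq_bigr => i _.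
rewrite rmorphXn /coord; case: ifP => [/m_off->|/negbT iL]; first by rewrite !expr0.
by rewrite /= relabelX enum_rankK slot_y.
Qed.

Lemma elim_gens i : elim (gens i) = 0.
Proof.
rewrite /gens; case: ifP => [iL|/negbT iL].
  by rewrite elimXU /coord iL tofrac0.
have defy : tag_of (tagged (y i)) = y i by case: (y i).
rewrite rmorph_sum /= (bigD1 (tagged (y i))) //= -mul_mpolyC rmorphM /=.
rewrite defy elimC elim_coefX enum_rankK slot_y // elim_X divfK; last first.
  by rewrite tofrac_eq0 coord_off // => l; apply: y_off.
apply/eqP; rewrite addrC addr_eq0 opprK /rest rmorph_sum; apply/eqP.
apply: eq_big => [a|a neq_a]; first by rewrite eq_tag_of.
rewrite -mul_mpolyC [LHS]rmorphM /= elimC elim_coefX enum_rankK elim_X tofracM.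
by rewrite slot_rest // eq_tag_of.
Qed.

Definition reducible P := exists (m : 'X_{1..n}) P',
  (forall l, l \in L -> m l = 0%N) /\ ideal gens ('X_[m] * P - relabel P').

(** Modulo [gens], the equation [tag (y i)] expresses the eliminated coefficient times its monomial
    through the other coefficients and the coordinates. Clearing such monomials is the only
    localization involved. *)
Lemma elim_reduce P : reducible P.
Proof.
have idX l : l \in L -> ideal gens 'X_l.
  by move=> lL; have := ideal_gen gens l; rewrite /gens lL.
have id_mon m : ideal gens ('X_[m] - relabel (mmap1 coord m)).
  have [/forallP m_off|] := boolP [forall l, (l \in L) ==> (m l == 0%N)].
    rewrite relabel_coord ?subrr => [|l lL]; first exact: ideal0.
    by apply/eqP; apply: (implyP (m_off l)).
  rewrite negb_forall => /existsP[l]; rewrite negb_imply => /andP[lL nz].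
  rewrite (coord_on lL nz) rmorph0 subr0 mpolyXE_id (bigD1 l) //=.
  apply: idealMr; rewrite -(prednK (_ : 0 < m l)%N) ?lt0n // exprS.
  by apply: idealMr; apply: idX.
have redD P1 P2 : reducible P1 -> reducible P2 -> reducible (P1 + P2).
  move=> [m1 [Q1 [off1 h1]]] [m2 [Q2 [off2 h2]]].
  exists (m1 + m2)%MM, (mmap1 coord m2 * Q1 + mmap1 coord m1 * Q2); split.
    by move=> l lL; rewrite mnmDE off1 // off2.
  rewrite rmorphD !rmorphM /= !relabel_coord // mpolyXD cross_addB.
  exact: (idealD (idealMl _ h1) (idealMl _ h2)).
have redM P1 P2 : reducible P1 -> reducible P2 -> reducible (P1 * P2).
  move=> [m1 [Q1 [off1 h1]]] [m2 [Q2 [off2 h2]]].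
  exists (m1 + m2)%MM, (Q1 * Q2); split.
    by move=> l lL; rewrite mnmDE off1 // off2.
  rewrite rmorphM /= mpolyXD cross_mulB.
  exact: (idealD (idealMl _ h1) (idealMl _ h2)).
move: P; apply: mpoly_ring_ind => [|i|//|//]; last first.
  have [iL|iL] := boolP (i \in L).
    exists 0%MM, 0; split=> [l _|]; first by rewrite mnm0E.
    by rewrite mpolyX0 mul1r rmorph0 subr0; apply: idX.
  exists 0%MM, (coord i); split=> [l _|]; first by rewrite mnm0E.
  rewrite mpolyX0 mul1r /coord (negPf iL) relabelX enum_rankK slot_y // subrr.
  exact: ideal0.
apply: (@mpoly_ring_ind _ _ (fun c => reducible c%:MP)) => [c|k|p q|p q]; last 2 first.
- by rewrite mpolyCD; apply: redD.
- by rewrite mpolyCM; apply: redM.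
- exists 0%MM, c%:MP; split=> [l _|]; first by rewrite mnm0E.
  by rewrite mpolyX0 mul1r relabelC subrr; apply: ideal0.
have [[i [iL yi def_slot]]|[_ def_slot]] := slotP (enum_val k); last first.
  exists 0%MM, 'X_k; split=> [l _|]; first by rewrite mnm0E.
  by rewrite mpolyX0 mul1r relabelX def_slot subrr; apply: ideal0.
exists (mnm_of (y i)), (- rest i); split=> [l lL|]; first exact: y_off.
have iy := ideal_gen gens i; rewrite /gens (negPf iL) in iy.
have defy : tag_of (tagged (y i)) = y i by case: (y i).
rewrite rmorphN opprK /= /rest rmorph_sum /=.
have def_univ : univ (tag (y i)) = 'X_[mnm_of (y i)] * ('X_k)%:MP +
    \sum_(a : A (tag (y i)) | tag_of a != y i)
      ('X_(enum_rank (tag_of a)))%:MP * 'X_[val a].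
  rewrite /univ (bigD1 (tagged (y i))) //= defy yi enum_valK mulrC mul_mpolyC.
  congr (_ + _); apply: eq_big => [a|a _]; first by rewrite eq_tag_of.
  by rewrite mul_mpolyC.
have -> : 'X_[mnm_of (y i)] * ('X_k)%:MP + \sum_(a : A (tag (y i)) | tag_of a != y i)
   relabel ('X_(enum_rank (tag_of a)) * mmap1 coord (val a)) =
  univ (tag (y i)) - \sum_(a : A (tag (y i)) | tag_of a != y i)
   ('X_(enum_rank (tag_of a)))%:MP * ('X_[val a] - relabel (mmap1 coord (val a))).
  rewrite def_univ - [RHS]addrA; congr (_ + _).
  rewrite -sumrB; apply: eq_bigr => a neq_a.
  rewrite rmorphM /= relabelX enum_rankK slot_rest //.
  by rewrite mulrBr opprB addrC subrK.
apply: idealB => //; apply: ideal_sum => a _; exact: idealMl.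
Qed.

Lemma elim_ideal P : ideal gens P -> elim P = 0.
Proof.
move=> [q ->]; rewrite rmorph_sum /= big1 // => i _.
by rewrite rmorphM /= elim_gens mulr0.
Qed.

(** The kernel lies in the saturation of the ideal of [gens] by the monomials off [L]: after
    reduction [elim] only sees [relabel P'], and it is injective on such elements. *)
Lemma elim_kernel P : elim P = 0 ->
  exists2 m : 'X_{1..n}, (forall l, l \in L -> m l = 0%N) & ideal gens ('X_[m] * P).
Proof.
move=> P0; have [m [P' [m_off hP]]] := elim_reduce P; exists m => //.
suff P'0 : P' = 0 by rewrite P'0 rmorph0 subr0 in hP.
apply/eqP; rewrite -tofrac_eq0 -elim_relabel.
have := elim_ideal hP; rewrite rmorphB rmorphM /= P0 mulr0 sub0r => /eqP.
by rewrite oppr_eq0.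
Qed.

(** The target field has as many variables as there are coefficients, so [elim p] and the images of
    all coefficients are algebraically dependent. A relation of least size is kept. *)
Lemma elim_dependent p : exists F : {poly Co}, [/\ F != 0,
  elim (map_poly (@mpolyC n Co) F).[p] = 0 &
  forall F' : {poly Co}, (size F' < size F)%N ->
    elim (map_poly (@mpolyC n Co) F').[p] = 0 -> F' = 0].
Proof.
pose P k := `[<exists F : {poly Co}, [/\ F != 0,
  elim (map_poly (@mpolyC n Co) F).[p] = 0 & size F = k]>].
have elim_horner (F : {poly Co}) :
    elim (map_poly (@mpolyC n Co) F).[p] = (map_poly elim_coef F).[elim p].
  rewrite -horner_map -map_poly_comp /=; congr (_.[_]).
  by apply: eq_map_poly => a /=; rewrite elimC.
have exP : exists k, P k.
  have [F nzF F0] := algebraic_dependence (elim p) elim_coefC.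
  exists (size F); apply/asboolP; exists F; split=> //.
  exact: etrans (elim_horner F) F0.
case: (ex_minnP exP) => k /asboolP[F [nzF F0 defk]] min_k.
exists F; split=> // F' lt_F' F'0; apply/eqP/negPn/negP => nzF'.
have : (size F < (size F).+1)%N by [].
have : (k <= size F')%N by apply: min_k; apply/asboolP; exists F'.
by rewrite -defk leqNgt lt_F'.
Qed.

(** In a shortest relation for [p] the constant term [Q] is nonzero, as otherwise [elim p], nonzero
    in a field, could be divided out. On the incidence variety [Q] is thus a multiple of [p]. *)
Lemma incidence_generic p : elim p != 0 ->
  exists (Q : Co) (m : 'X_{1..n}) G, [/\ Q != 0, forall l, l \in L -> m l = 0%N &
    ideal gens ('X_[m] * (Q%:MP + p * G))].
Proof.
move=> nz_p; have [F [nzF F0 minF]] := elim_dependent p.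
have [m m_off hm] := elim_kernel F0.
have defF : F = (F`_0)%:P + 'X * drop_poly 1 F.
  rewrite -{1}(poly_take_drop 1 F) expr1 [_ * 'X]mulrC; congr (_ + _).
  apply/polyP => i; rewrite coef_take_poly coefC; by case: i.
exists F`_0, m, (map_poly (@mpolyC n Co) (drop_poly 1 F)).[p]; split=> //.
  apply/eqP => F00; rewrite F00 polyC0 add0r in defF.
  have nzD : drop_poly 1 F != 0.
    by apply: contraNneq nzF => D0; rewrite defF D0 mulr0.
  case: (elimN eqP nzD); apply: minF.
    by rewrite [in ltnRHS]defF mulrC size_mulX.
  move: F0; rewrite {1}defF rmorphM /= map_polyX hornerM hornerX rmorphM /= => /eqP.
  by rewrite mulf_eq0 (negPf nz_p) => /eqP.
rewrite {1}defF rmorphD rmorphM /= map_polyC map_polyX hornerD hornerM hornerX hornerC in hm.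
exact: hm.
Qed.

End Universal.

Opaque elim_coef elim relabel.

Lemma mderivXU (C : comNzRingType) (n : nat) (i l : 'I_n) :
  ('X_i : {mpoly C[n]})^`M(l) = (i == l)%:R.
Proof.
rewrite mderivX mnm1E; case: eqP => [->|_]; last by rewrite scale0r.
rewrite scale1r (_ : (U_(l) - U_(l))%MM = 0%MM) ?mpolyX0 //.
by apply/mnmP => j; rewrite mnmBE subnn mnm0E.
Qed.

Lemma mderiv_horner (C : comNzRingType) (n : nat) (f : {poly C}) (i l : 'I_n) :
  ((map_poly (@mpolyC n C) f).['X_i])^`M(l) =
  (map_poly (@mpolyC n C) f^`()).['X_i] *+ (i == l).
Proof.
elim/poly_ind: f => [|f a IHf].
  by rewrite deriv0 !(rmorph0, horner0, mderiv0) mul0rn.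
rewrite derivMXaddC !rmorphD !rmorphM /= !map_polyX !map_polyC !hornerE /=.
rewrite mderivD mderivM mderivC addr0 IHf mderivXU.
have [->|neq] := eqVneq i l; last by rewrite !mulr0n mul0r mulr0 addr0.
by rewrite !mulr1n mulr1 addrC.
Qed.

Lemma meval_horner (C : comNzRingType) (n : nat) (f : {poly C}) (i : 'I_n) z :
  ((map_poly (@mpolyC n C) f).['X_i]).@[z] = f.[z i].
Proof.
rewrite -horner_map /= mevalXU -map_poly_comp map_poly_id // => a _ /=.
by rewrite mevalC.
Qed.

Lemma meval_monomial_off (C : fieldType) (n : nat) (L : {set 'I_n})
    (m : 'X_{1..n}) (z : 'I_n -> C) :
  (forall l, l \in L -> m l = 0%N) -> (forall i, i \notin L -> z i != 0) ->
  ('X_[m] : {mpoly C[n]}).@[z] != 0.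
Proof.
move=> m_off z_on; rewrite mevalX; apply/prodf_neq0 => i _.
have [/m_off->|/z_on nz] := boolP (i \in L); first by rewrite expr0 oner_neq0.
by rewrite expf_neq0.
Qed.

Section Specialization.
Variables (C : fieldType) (n N : nat).
Local Notation Co := {mpoly C[N]}.

Definition spec (c : 'I_N -> C) : {rmorphism {mpoly Co[n]} -> {mpoly C[n]}} :=
  map_mpoly (meval c).

Lemma specC c a : spec c a%:MP = (a.@[c])%:MP.
Proof. exact: map_mpolyC. Qed.

Lemma specX c m : spec c 'X_[m] = 'X_[m].
Proof. exact: map_mpolyX. Qed.

Lemma specZ c a P : spec c (a *: P) = a.@[c] *: spec c P.
Proof. exact: map_mpolyZ. Qed.

Opaque spec.

Lemma spec_horner c (F : {poly Co}) i :
  spec c (map_poly (@mpolyC n Co) F).['X_i] =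
  (map_poly (@mpolyC n C) (map_poly (meval c) F)).['X_i].
Proof.
rewrite -horner_map /= specX -!map_poly_comp; congr (horner _ _).
by apply: eq_map_poly => a /=; rewrite specC.
Qed.

End Specialization.

Arguments spec {C n N} c.
Opaque spec.

Section Stratum.
Variables (C : numFieldType) (n : nat) (K : finType) (A : K -> {fset 'X_{1..n}}).
Local Notation T := {j : K & A j}.
Local Notation Co := {mpoly C[#|{: T}|]}.
Variables (L : {set 'I_n}) (y : 'I_n -> T).
Hypothesis y_off : forall i l, i \notin L -> l \in L -> mnm_of (y i) l = 0%N.
Hypothesis y_inj : forall i i', i \notin L -> i' \notin L ->
  tag (y i) = tag (y i') -> i = i'.
Local Notation G := (gens C L y).

Definition stratum_zero (c : 'I_#|{: T}| -> C) (z : 'I_n -> C) :=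
  (forall i, i \notin L -> z i != 0) /\ (forall i, (spec c (G i)).@[z] = 0).

Lemma spec_ideal c z P : stratum_zero c z -> ideal G P -> (spec c P).@[z] = 0.
Proof.
move=> [_ z0] /(ideal_rmorph (spec c))[q ->]; rewrite rmorph_sum big1 // => i _.
by rewrite /= mevalM z0 mulr0.
Qed.

Lemma stratum_generic p : elim C L y p != 0 ->
  exists2 Q : Co, Q != 0 & forall c z,
    Q.@[c] != 0 -> stratum_zero c z -> (spec c p).@[z] != 0.
Proof.
move=> nz_p; have [Q [m [H [nzQ m_off hm]]]] := incidence_generic y_off y_inj nz_p.
exists Q => // c z nzQc zz; have := spec_ideal zz hm.
rewrite (rmorphM (spec c)) (rmorphD (spec c)) (rmorphM (spec c)) specC specX.
rewrite mevalM mevalD mevalM mevalC => /eqP.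
rewrite mulf_eq0 (negPf (meval_monomial_off m_off zz.1)) /=.
by apply: contraTneq => ->; rewrite mul0r addr0.
Qed.

(** Each coordinate off [L] satisfies a relation [F] over the coefficients, and a monomial times the
    value of [F] at ['X_i] is in the ideal of [gens]. Differentiating at [z] writes a multiple of
    the [i]-th unit vector as a combination of rows of the Jacobian; the factor is nonzero when the
    derivative of [F] is nonzero at [z]. *)
Lemma stratum_jacobian : exists2 Q : Co, Q != 0 & forall c z,
  Q.@[c] != 0 -> stratum_zero c z ->
  \det (\matrix_(i, l) ((spec c (G i))^`M(l)).@[z]) != 0.
Proof.
suff /choice[Q hQ] : forall i : 'I_n, exists Q : Co, Q != 0 /\ forall c z,
    Q.@[c] != 0 -> stratum_zero c z -> exists u (q : 'I_n -> C), u != 0 /\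
    forall l, \sum_j q j * ((spec c (G j))^`M(l)).@[z] = u *+ (i == l).
  exists (\prod_i Q i); first by apply/prodf_neq0 => i _; have [] := hQ i.
  move=> c z; rewrite rmorph_prod => /prodf_neq0 nzQ zz.
  have /choice[u /choice[q huq]] i := (hQ i).2 c z (nzQ i isT) zz.
  set M := (X in \det X).
  have : \det ((\matrix_(i, j) q i j) *m M) != 0.
    have -> : (\matrix_(i, j) q i j) *m M = diag_mx (\row_i u i).
      apply/matrixP => i l; rewrite !mxE; under eq_bigr do rewrite !mxE.
      by have [_ ->] := huq i.
    by rewrite det_diag; apply/prodf_neq0 => i _; rewrite mxE; have [] := huq i.
  by rewrite det_mulmx mulf_eq0 negb_or => /andP[].
move=> i; have [iL|iL] := boolP (i \in L).
  exists 1; split=> [|c z _ zz]; first exact: oner_neq0.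
  exists 1, (fun j => (j == i)%:R); split=> [|l]; first exact: oner_neq0.
  rewrite (bigD1 i) //= eqxx mul1r big1 ?addr0; last first.
    by move=> j /negPf->; rewrite mul0r.
  by rewrite {1}/gens iL specX mderivXU rmorph_nat.
have [F [nzF F0 minF]] := @elim_dependent C n K A L y 'X_i.
have [m m_off hm] := @elim_kernel C n K A L y y_off y_inj _ F0.
have zF c z : stratum_zero c z -> (map_poly (meval c) F).[z i] = 0.
  move=> zz; have := spec_ideal zz hm.
  rewrite (rmorphM (spec c)) specX spec_horner mevalM meval_horner => /eqP.
  by rewrite mulf_eq0 (negPf (meval_monomial_off m_off zz.1)) => /eqP.
(* In characteristic 0 a zero derivative makes [F] a nonzero constant. It vanishes at every [c] with
   a zero in the stratum, so taking it as [Q] leaves no case. *)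
have [dF0|nz_dF] := eqVneq F^`() 0.
  have constF : F = (F`_0)%:P.
    apply/polyP => -[|k]; rewrite coefC //=.
    have := congr1 (fun p : {poly Co} => p`_k) dF0; rewrite coef_deriv coef0.
    move=> Fk; apply/mpolyP => e; have := congr1 (mcoeff e) Fk.
    by rewrite mcoeffMn mcoeff0 => /eqP; rewrite mulrn_eq0 => /eqP.
  exists F`_0; split=> [|c z nz_c zz].
    by apply: contraNneq nzF => F00; rewrite constF F00.
  have := zF c z zz; rewrite constF map_polyC hornerC /= => F0c.
  by rewrite F0c eqxx in nz_c.
(* The derivative is shorter than [F], hence by minimality not a relation for ['X_i]. *)
have nz_el : elim C L y (map_poly (@mpolyC n Co) F^`()).['X_i] != 0.
  apply: contraNneq nz_dF => /minF->//; exact: lt_size_deriv.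
have [Q nzQ hQ] := stratum_generic nz_el.
exists Q; split=> // c z nz_c zz.
have nz_X := meval_monomial_off m_off zz.1.
have [q def_q] := ideal_rmorph (spec c) hm.
exists (('X_[m] : {mpoly C[n]}).@[z] * (map_poly (meval c) F)^`().[z i]).
exists (fun j => (q j).@[z]); split=> [|l].
  rewrite mulf_neq0 //; have := hQ c z nz_c zz.
  by rewrite spec_horner meval_horner deriv_map.
have := congr1 (fun P => (P^`M(l)).@[z]) def_q.
rewrite (rmorphM (spec c)) specX spec_horner mderivM mevalD !mevalM.
rewrite meval_horner (zF c z zz) mulr0 add0r mderiv_horner mevalMn meval_horner.
rewrite mulrnAr => ->; rewrite (raddf_sum (mderiv l)) (raddf_sum (meval z)) /=.
apply: eq_bigr => j _; rewrite mderivM mevalD !mevalM.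
by rewrite zz.2 mulr0 add0r.
Qed.

End Stratum.

Definition peval (C : comNzRingType) (n r : nat) (X : 'I_n -> {mpoly C[r]}) :
  {rmorphism {mpoly C[n]} -> {mpoly C[r]}} := mmap (@mpolyC r C) X.

(** * Implicit functions *)

Lemma mul_subMM (S : comNzRingType) (a b a' b' : S) :
  a' * b' - a * b = (a' - a) * b + a' * (b' - b).
Proof. by ring. Qed.

(** First-order Taylor formula, by the product rule. The two points [phi] and [phi'] live in any
    ring over [z], which covers both the Newton iteration and the comparison of coordinates with
    their expansions. *)
Lemma rmorph_taylor (C S : comNzRingType) (n : nat)
    (phi phi' : {rmorphism {mpoly C[n]} -> S}) (ev : {rmorphism S -> C})
    (z : 'I_n -> C) :
  (forall c, phi c%:MP = phi' c%:MP) -> (forall c, ev (phi c%:MP) = c) ->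
  (forall i, ev (phi 'X_i) = z i) -> (forall i, ev (phi' 'X_i) = z i) ->
  forall P, exists A : 'I_n -> S,
    phi' P - phi P = \sum_l A l * (phi' 'X_l - phi 'X_l) /\
    forall l, ev (A l) = (P^`M(l)).@[z].
Proof.
move=> eqC evC evX evX'.
have evP P : ev (phi P) = P.@[z].
  move: P; apply: (@eq_rmorph_mpoly _ _ _ (ev \o phi) (meval z)) => [c|i] /=.
    by rewrite evC mevalC.
  by rewrite evX mevalXU.
have evP' P : ev (phi' P) = P.@[z].
  move: P; apply: (@eq_rmorph_mpoly _ _ _ (ev \o phi') (meval z)) => [c|i] /=.
    by rewrite -eqC evC mevalC.
  by rewrite evX' mevalXU.
apply: mpoly_ring_ind => [c|i|P Q [A [defA evA]] [B [defB evB]]|P Q [A [defA evA]] [B [defB evB]]].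
- exists (fun=> 0); split=> [|l]; last by rewrite rmorph0 mderivC meval0.
  by rewrite eqC subrr big1 // => l _; rewrite mul0r.
- exists (fun l => (l == i)%:R); split=> [|l].
    rewrite (bigD1 i) //= eqxx mul1r big1 ?addr0 // => l /negPf->.
    by rewrite mul0r.
  by rewrite mderivXU !rmorph_nat eq_sym.
- exists (fun l => A l + B l); split=> [|l]; last by rewrite rmorphD evA evB mderivD mevalD.
  rewrite !rmorphD opprD addrACA defA defB -big_split /=.
  by apply: eq_bigr => l _; rewrite mulrDl.
- exists (fun l => A l * phi Q + phi' P * B l); split=> [|l].
    rewrite !rmorphM /= mul_subMM defA defB mulr_suml mulr_sumr -big_split /=.
    by apply: eq_bigr => l _; rewrite mulrDl mulrAC mulrA.
  by rewrite rmorphD !rmorphM /= evP evP' evA evB mderivM mevalD !mevalM.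
Qed.

Section Peval.
Variables (C : comNzRingType) (n r : nat).
Implicit Types (X : 'I_n -> {mpoly C[r]}) (P : {mpoly C[n]}).

Lemma pevalC X c : peval X c%:MP = c%:MP.
Proof. exact: mmapC. Qed.

Lemma pevalXU X i : peval X 'X_i = X i.
Proof. by rewrite [LHS]mmapX mmap1U. Qed.

Opaque peval.

Lemma mcoeff0_peval X P : (peval X P)@_0%MM = P.@[fun i => (X i)@_0%MM].
Proof.
move: P; apply: (@eq_rmorph_mpoly _ _ _ (mcoeff 0%MM \o peval X)
  (meval (fun i => (X i)@_0%MM))) => [c|i] /=.
- by rewrite pevalC mcoeffC eqxx mulr1 mevalC.
- by rewrite pevalXU mevalXU.
Qed.

Lemma meval_peval X P z : (peval X P).@[z] = P.@[fun i => (X i).@[z]].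
Proof.
move: P; apply: (@eq_rmorph_mpoly _ _ _ (meval z \o peval X)
  (meval (fun i => (X i).@[z]))) => [c|i] /=.
- by rewrite pevalC !mevalC.
- by rewrite pevalXU mevalXU.
Qed.

End Peval.

Lemma peval_id (C : comNzRingType) (n : nat) (P : {mpoly C[n]}) :
  peval (fun i => 'X_i) P = P.
Proof.
move: P; apply: (@eq_rmorph_mpoly _ _ _ (peval _) idfun) => [c|i] /=.
- by rewrite pevalC.
- by rewrite pevalXU.
Qed.

Opaque peval.

Lemma ord_geZ (C : comNzRingType) (r N : nat) (a : C) (p : {mpoly C[r]}) :
  ord_ge N p -> ord_ge N (a *: p).
Proof. by move=> hp m lt_m; rewrite mcoeffZ hp ?mulr0. Qed.

Lemma ord_ge_sum (C : comNzRingType) (r N : nat) (I : Type) (s : seq I) (Pr : pred I)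
    (F : I -> {mpoly C[r]}) :
  (forall i, Pr i -> ord_ge N (F i)) -> ord_ge N (\sum_(i <- s | Pr i) F i).
Proof.
move=> h; apply: big_ind => //; first by move=> m _; rewrite mcoeff0.
exact: ord_geD.
Qed.

Section Implicit.
Variables (C : fieldType) (n r : nat) (e : 'I_r -> 'I_n).
Hypothesis e_inj : injective e.
Variables (z : 'I_n -> C) (G : 'I_n -> {mpoly C[n]}).
Hypothesis z_e : forall k, z (e k) = 0.
Hypothesis G_e : forall k, G (e k) = 'X_(e k).
Hypothesis G_z : forall i, (G i).@[z] = 0.

Let M := \matrix_(i, l) ((G i)^`M(l)).@[z].
Hypothesis nz_M : \det M != 0.

(** The value prescribed for [G i] along the solution: ['X_k] if [i = e k], and 0 off the image of
    [e]. *)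
Definition free_coord (i : 'I_n) : {mpoly C[r]} := \sum_k 'X_k *+ (e k == i).

Lemma free_coordE k : free_coord (e k) = 'X_k.
Proof.
rewrite /free_coord (bigD1 k) //= eqxx big1 ?addr0 // => l.
by rewrite (inj_eq e_inj) => /negPf->.
Qed.

Lemma free_coord_off i : (forall k, e k != i) -> free_coord i = 0.
Proof. by move=> off; rewrite /free_coord big1 // => k _; rewrite (negPf (off k)). Qed.

Lemma ord_ge_free_coord i : ord_ge 1 (free_coord i).
Proof.
apply: ord_ge_sum => k _; case: eqP => _; rewrite ?mulr0n; last first.
  by move=> m _; rewrite mcoeff0.
by apply: ord_geX; rewrite mdeg1.
Qed.

(** Newton iteration with the fixed Jacobian [M] at [z], gaining one order per step. It starts from
    [z] displaced along the free coordinates. *)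
Lemma implicit_solution N : exists X : 'I_n -> {mpoly C[r]},
  [/\ forall i, (X i)@_0%MM = z i, forall k, X (e k) = 'X_k &
      forall i, ord_ge N.+1 (peval X (G i) - free_coord i)].
Proof.
have fc0 i : (free_coord i)@_0%MM = 0 by apply/ord_ge1P/ord_ge_free_coord.
elim: N => [|N [X [X0 Xe XG]]].
  exists (fun i => free_coord i + (z i)%:MP); split=> [i|k|i].
  - by rewrite mcoeffD fc0 mcoeffC eqxx mulr1 add0r.
  - by rewrite free_coordE z_e mpolyC0 addr0.
  - apply/ord_ge1P; rewrite mcoeffB fc0 subr0 mcoeff0_peval.
    rewrite -[RHS](G_z i); apply: meval_eq => l.
    by rewrite mcoeffD fc0 mcoeffC eqxx mulr1 add0r.
pose v i := peval X (G i) - free_coord i.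
pose del i := - \sum_j (invmx M) i j *: v j.
have ord_del i : ord_ge N.+1 (del i).
  by apply/ord_geN/ord_ge_sum => j _; apply: ord_geZ (XG j).
have M_del i : \sum_l M i l *: del l = - v i.
  transitivity (- \sum_j (M *m invmx M) i j *: v j).
    under [X in - X]eq_bigr do rewrite mxE scaler_suml.
    rewrite exchange_big /= -sumrN; apply: eq_bigr => l _.
    by rewrite scalerN scaler_sumr; congr (- _); apply: eq_bigr => j _; rewrite scalerA.
  rewrite mulmxV ?unitmxE ?unitfE //; congr (- _).
  rewrite (bigD1 i) //= mxE eqxx scale1r big1 ?addr0 // => j.
  by rewrite mxE eq_sym => /negPf->; rewrite scale0r.
have M_e k l : M (e k) l = (l == e k)%:R.
  by rewrite mxE G_e mderivXU rmorph_nat eq_sym.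
exists (fun i => X i + del i); split=> [i|k|i].
- rewrite mcoeffD X0 [(del i)@__](ord_del i) ?mdeg0 ?addr0 //.
- have := M_del (e k); rewrite /v G_e pevalXU Xe free_coordE subrr oppr0.
  rewrite (bigD1 (e k)) //= M_e eqxx scale1r big1 ?addr0 => [->|l /negPf neq].
    by rewrite addr0.
  by rewrite M_e neq scale0r.
have [||||A [defA evA]] := @rmorph_taylor _ _ _ (peval X)
    (peval (fun i => X i + del i)) (mcoeff 0%MM) z _ _ _ _ (G i).
- by move=> c; apply: etrans (pevalC X c) (esym (pevalC _ c)).
- by move=> c /=; rewrite pevalC mcoeffC eqxx mulr1.
- by move=> l /=; rewrite pevalXU.
- by move=> l /=; rewrite pevalXU mcoeffD X0 (ord_del l) ?mdeg0 ?addr0.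
(* By the choice of [del] the linear part cancels; the remaining factors [A l - (M i l)%:MP] have no
   constant term, which gains one order. *)
have -> : peval (fun i => X i + del i) (G i) - free_coord i =
    \sum_l (A l - (M i l)%:MP) * del l.
  under [RHS]eq_bigr do rewrite mulrBl mul_mpolyC.
  rewrite sumrB M_del opprK /v addrA; congr (_ - _).
  apply/eqP; rewrite -subr_eq defA; apply/eqP/eq_bigr => l _.
  have subK (p p' q : {mpoly C[r]}) : p = X l -> p' = X l + q -> p' - p = q.
    by move=> -> ->; rewrite addrAC subrr add0r.
  by congr (_ * _); apply: subK; apply: pevalXU.
apply: ord_ge_sum => l _; rewrite -add1n; apply: ord_geMl => //.
apply/ord_ge1P; rewrite mcoeffB mcoeffC eqxx mulr1 mxE; apply/eqP.
by rewrite subr_eq0 -evA.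
Qed.

End Implicit.

Lemma mnm_split n (m : 'X_{1..n}) d : (d <= mdeg m)%N ->
  exists m1 m2, m = (m1 + m2)%MM /\ mdeg m1 = d.
Proof.
elim: d => [|d IHd] le_d.
  by exists 0%MM, m; rewrite add0m mdeg0.
have [m1 [m2 [def_m deg_m1]]] := IHd (ltnW le_d).
have [i nz_i] : exists i, m2 i != 0%N.
  apply/existsP; apply: contraTT le_d; rewrite negb_exists => /forallP z2.
  rewrite def_m mdegD deg_m1 -ltnNge ltnS.
  have -> : m2 = 0%MM by apply/mnmP => i; rewrite mnm0E; apply/eqP; rewrite -[_ == _]negbK.
  by rewrite mdeg0 addn0.
exists (m1 + U_(i))%MM, (m2 - U_(i))%MM; rewrite mdegD mdeg1 deg_m1 addn1; split=> //.
by rewrite def_m -addmA [(U_(i) + _)%MM]addmC submK // lep1mP.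
Qed.

Lemma mcoeff0_meval (C : comNzRingType) (n : nat) (P : {mpoly C[n]}) :
  P@_0%MM = P.@[fun=> 0].
Proof.
move: P; apply: (@eq_rmorph_mpoly _ _ _ (mcoeff 0%MM) (meval (fun=> 0))) => [c|i] /=.
- by rewrite mcoeffC eqxx mulr1 mevalC.
- by rewrite mcoeffX mnm1_eq0 mevalXU.
Qed.

Lemma mul_inv_sub (S : comNzRingType) (p u s : S) :
  p = s * (u * p) - p * (u * s - 1).
Proof. by ring. Qed.

(** * Comparison of the local ideals of the full and the residual system *)

Section Transfer.
Variables (C : fieldType) (n r : nat) (e : 'I_r -> 'I_n).
Variables (z : 'I_n -> C) (G : 'I_n -> {mpoly C[n]}).
Hypothesis z_e : forall k, z (e k) = 0.
Hypothesis G_e : forall k, G (e k) = 'X_(e k).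
Hypothesis nz_M : \det (\matrix_(i, l) ((G i)^`M(l)).@[z]) != 0.
Variables (d : nat) (X : 'I_n -> {mpoly C[r]}).
Hypothesis X0 : forall i, (X i)@_0%MM = z i.
Hypothesis X_e : forall k, X (e k) = 'X_k.
Hypothesis X_G : forall i, (forall k, e k != i) -> ord_ge d.+1 (peval X (G i)).
Variables (J J' : finType) (f : J -> {mpoly C[n]}) (g : J' -> {mpoly C[r]}).
Hypothesis f_G : forall i, (forall k, e k != i) -> ideal f (G i).
Hypothesis f_g : forall j, idealp g d.+1 (peval X (f j)).
Hypothesis g_f : forall j, exists2 P, ideal f P & peval X P = g j.
Hypothesis g_deg : forall m, mdeg m = d -> idealp g d.+1 'X_[m].

Let iota : {rmorphism {mpoly C[r]} -> {mpoly C[n]}} := peval (fun k => 'X_(e k)).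

(** Expansions are known only to order [d.+1], so [fm] enlarges [f] by the monomials of degree
    [d.+1] in the free coordinates, to be removed by Nakayama's lemma. The lower degrees of the
    finite index type get the value 0. *)
Let mons (m : 'X_{1..r < d.+2}) : {mpoly C[n]} :=
  if mdeg m == d.+1 then iota 'X_[m] else 0.

Let fm (s : J + 'X_{1..r < d.+2}) : {mpoly C[n]} :=
  match s with inl j => f j | inr m => mons m end.

Lemma peval_iota p : peval X (iota p) = p.
Proof.
move: p; apply: (@eq_rmorph_mpoly _ _ _ (peval X \o iota) idfun) => [c|k] /=.
- by rewrite /iota !pevalC.
- by rewrite /iota !pevalXU.
Qed.

Lemma peval_origin P : (peval X P)@_0%MM = P.@[z].
Proof. by rewrite mcoeff0_peval; apply: meval_eq. Qed.

Lemma iota_ord p : ord_ge d.+1 p -> ideal fm (iota p).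
Proof.
move=> op; rewrite (mpolyE p) rmorph_sum big_seq; apply: ideal_sum => m m_in.
have le_m : (d.+1 <= mdeg m)%N.
  by rewrite leqNgt; apply: contraL m_in => /op/eqP; rewrite mcoeff_eq0.
have [m1 [m2 [-> deg_m1]]] := mnm_split le_m.
have lt_m1 : (mdeg m1 < d.+2)%N by rewrite deg_m1.
rewrite -mul_mpolyC mpolyXD (rmorphM iota) (rmorphM iota); apply: idealMl.
apply: idealMr; have := ideal_gen fm (inr (BMultinom lt_m1)).
by rewrite /= /mons /= deg_m1 eqxx.
Qed.

Lemma ideal_fm P : ideal f P -> ideal fm P.
Proof. by apply: ideal_sub => j; apply: (ideal_gen fm (inl j)). Qed.

(** These differences solve a linear system whose right-hand sides [G j - iota (peval X (G j))] are
    in the ideal of [fm], and whose matrix at [z] is the Jacobian. *)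
Lemma loc_coord i : loc fm z ('X_i - iota (X i)).
Proof.
have taylor j : exists A : 'I_n -> {mpoly C[n]},
    loc fm z (\sum_l A l * ('X_l - iota (X l))) /\
    forall l, (A l).@[z] = ((G j)^`M(l)).@[z].
  have [||||A [defA evA]] := @rmorph_taylor _ _ _ (iota \o peval X) idfun
      (meval z) z _ _ _ _ (G j).
  - by move=> c /=; rewrite /iota !pevalC.
  - by move=> c /=; rewrite /iota !pevalC mevalC.
  - move=> l /=; rewrite pevalXU /iota meval_peval -X0 mcoeff0_meval.
    by apply: meval_eq => k; rewrite mevalXU z_e.
  - by move=> l /=; rewrite mevalXU.
  exists A; split=> //; rewrite /= in defA.
  have <- : G j - iota (peval X (G j)) = \sum_l A l * ('X_l - iota (X l)).
    by rewrite defA; apply: eq_bigr => l _; rewrite pevalXU.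
  apply: loc_ideal.
  have [/existsP[k /eqP <-]|] := boolP [exists k, e k == j].
    rewrite G_e pevalXU X_e /iota pevalXU subrr; exact: ideal0.
  rewrite negb_exists => /forallP off; apply: idealB; first exact/ideal_fm/f_G.
  exact/iota_ord/X_G.
have /choice[A hA] := taylor.
apply: (@loc_det _ _ _ _ _ _ (\matrix_(j, l) A j l) (fun i => 'X_i - iota (X i))).
  rewrite -det_map_mx; congr (\det _ != 0): nz_M.
  apply/matrixP => j l; rewrite !mxE; have [_ h] := hA j; exact: esym (h l).
move=> j; have [h _] := hA j; congr (loc _ _ _): h.
by apply: eq_bigr => l _; rewrite mxE.
Qed.

Lemma loc_retract P : loc fm z (P - iota (peval X P)).
Proof.
move: P; apply: mpoly_ring_ind => [c|i|P Q hP hQ|P Q hP hQ].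
- by rewrite pevalC /iota pevalC subrr; apply: loc0.
- by rewrite pevalXU; apply: loc_coord.
- rewrite (rmorphD (peval X)) (rmorphD iota) opprD addrACA.
  exact: locD hP hQ.
- rewrite (rmorphM (peval X)) (rmorphM iota) mul_subMM.
  exact: locD (locMr _ hP) (locMl _ hQ).
Qed.

Lemma loc_lift P : idealp g d.+1 (peval X P) -> loc fm z P.
Proof.
move=> [q [s [[a def_q] os def_P]]]; have /choice[Pj hPj] : forall j, exists P,
    ideal f P /\ peval X P = g j by move=> j; have [Q] := g_f j; exists Q.
pose Q := \sum_j iota (a j) * Pj j.
have iQ : ideal f Q.
  by apply: ideal_sum => j _; apply: idealMl; have [] := hPj j.
have psiQ : peval X Q = q.
  rewrite def_q (rmorph_sum (peval X)); apply: eq_bigr => j _.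
  by rewrite (rmorphM (peval X)) peval_iota; have [_ ->] := hPj j.
have -> : P = Q + ((P - Q) - iota (peval X (P - Q))) + iota (peval X (P - Q)).
  by rewrite -addrA subrK addrC subrK.
apply: locD; first by apply: locD; [exact/loc_ideal/ideal_fm | exact: loc_retract].
rewrite (rmorphB (peval X)) psiQ def_P addrC addKr.
exact/loc_ideal/iota_ord.
Qed.

Let v (m : 'X_{1..r < d.+1}) := if mdeg m == d then iota 'X_[m] else 0.

Lemma mons_v m' : exists a : 'X_{1..r < d.+1} -> {mpoly C[n]},
  (forall j, (a j).@[z] = 0) /\ mons m' = \sum_j a j * v j.
Proof.
have [deg_m'|neq] := eqVneq (mdeg m') d.+1; last first.
  exists (fun=> 0); split=> [j|]; first by rewrite meval0.
  by rewrite /mons (negPf neq) big1 // => j _; rewrite mul0r.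
have le_d : (d <= mdeg m')%N by rewrite deg_m'.
have [m1 [m2 [def_m' deg_m1]]] := mnm_split le_d.
have /mdeg1P[k /eqP def_m2] : mdeg m2 == 1%N.
  by rewrite -(eqn_add2l (mdeg m1)) -mdegD -def_m' deg_m' deg_m1 addn1.
have lt_m1 : (mdeg m1 < d.+1)%N by rewrite deg_m1.
exists (fun j => if j == BMultinom lt_m1 then 'X_(e k) else 0); split=> [j|].
  by case: eqP => _; rewrite ?meval0 // mevalXU z_e.
rewrite (bigD1 (BMultinom lt_m1)) //= eqxx big1 ?addr0; last first.
  by move=> j /negPf->; rewrite mul0r.
rewrite /mons deg_m' eqxx /v /= deg_m1 eqxx def_m' def_m2 mpolyXD (rmorphM iota).
by rewrite mulrC /iota pevalXU.
Qed.

(** A monomial of degree [d] is locally in the ideal of [fm], and each member of [mons] is a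
    combination of such monomials with coefficients vanishing at [z]. Nakayama's lemma then discards
    [mons]. *)
Lemma loc_v m : loc f z (v m).
Proof.
have /choice[a ha] := mons_v; move: m; apply: loc_nakayama => m.
have [deg_m|neq] := eqVneq (mdeg m) d; last first.
  exists 1, (fun=> 0); split=> [|j|]; rewrite ?meval1 ?meval0 ?oner_neq0 //.
  rewrite /v (negPf neq) mulr0 big1 ?subr0; first exact: loc0.
  by move=> j _; rewrite mul0r.
have [u nz_u [q def_q]] : loc fm z (v m).
  rewrite /v deg_m eqxx; apply: loc_lift; rewrite peval_iota; exact: g_deg.
exists u, (fun j => \sum_m' q (inr m') * a m' j); split=> // [j|].
  by rewrite raddf_sum big1 //= => m' _; rewrite mevalM (ha m').1 mulr0.
apply: loc_ideal; exists (fun j => q (inl j)).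
rewrite def_q big_sumType /= - [RHS]addr0 - addrA; congr (_ + _).
apply/eqP; rewrite subr_eq0; apply/eqP.
under [RHS]eq_bigr do rewrite mulr_suml.
rewrite exchange_big /=; apply: eq_bigr => m' _; rewrite (ha m').2 mulr_sumr.
by apply: eq_bigr => j _; rewrite mulrA.
Qed.

(** From left to right, [loc_lift] is followed by the removal of [mons]. Conversely, a multiplier
    nonzero at [z] expands to a polynomial with nonzero constant term, invertible up to order
    [d.+1]. *)
Lemma loc_transfer P : idealp g d.+1 (peval X P) <-> loc f z P.
Proof.
split=> [/loc_lift|[u nz_u [q def_q]]].
  apply: loc_trans => -[j|m']; first exact/loc_ideal/ideal_gen.
  have [a [_ def_m']] := mons_v m'; rewrite /= def_m'.
  by apply: loc_sum => j _; apply/locMl/loc_v.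
have [|s hs] := @unit_mod _ _ d.+1 (peval X u); first by rewrite peval_origin.
rewrite (mul_inv_sub (peval X P) (peval X u) s) -(rmorphM (peval X)).
apply: idealpD; last exact/idealpN/idealpM/idealp_ord.
apply: idealpM; rewrite def_q (rmorph_sum (peval X)).
apply: big_ind => [||j _].
- by apply: idealp_ord => m _; rewrite mcoeff0.
- exact: idealpD.
- by rewrite (rmorphM (peval X)); apply/idealpM/f_g.
Qed.

End Transfer.

(** * Generic systems at the origin *)

Section NonVanishing.
Variable (C : numFieldType).

Lemma poly_eq0_everywhere (p : {poly C}) : (forall t, p.[t] = 0) -> p = 0.
Proof.
move=> h; apply/eqP/negPn/negP => nz_p.
have := @max_poly_roots _ _ [seq (k%:R : C) | k <- iota 0 (size p)] nz_p.
rewrite size_map size_iota ltnn => hroots.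
suff: false by []. apply: hroots; first by apply/allP => t _; apply/eqP.
by rewrite map_inj_uniq ?iota_uniq // => a b /eqP; rewrite eqr_nat => /eqP.
Qed.

Variable n : nat.
Implicit Types P : {mpoly C[n]}.

(** The restriction of [P] to the line through [v] in direction [i] is the zero polynomial, and its
    derivative at 0 is the partial derivative at [v]. *)
Lemma mderiv_eq0_everywhere P i :
  (forall v, P.@[v] = 0) -> forall v, (P^`M(i)).@[v] = 0.
Proof.
move=> P0 v; pose line : {rmorphism {mpoly C[n]} -> {poly C}} :=
  mmap (@polyC C) (fun j => (v j)%:P + 'X *+ (j == i)).
have lineC c : line c%:MP = c%:P by exact: mmapC.
have lineX j : line 'X_j = (v j)%:P + 'X *+ (j == i) by rewrite [LHS]mmapX mmap1U.
have line_eval t Q : (line Q).[t] = Q.@[fun j => v j + t *+ (j == i)].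
  move: Q; apply: (@eq_rmorph_mpoly _ _ _ (horner_eval t \o line) (meval _)) => [c|j] /=.
    by rewrite lineC mevalC horner_evalE hornerC.
  by rewrite lineX mevalXU horner_evalE hornerD hornerC hornerMn hornerX.
have line0 Q : (line Q).[0] = Q.@[v].
  by rewrite line_eval; apply: meval_eq => j; rewrite mul0rn addr0.
have line_deriv Q : (line Q)^`().[0] = (Q^`M(i)).@[v].
  move: Q; apply: mpoly_ring_ind => [c|j|Q1 Q2 h1 h2|Q1 Q2 h1 h2].
  - by rewrite lineC derivC horner0 mderivC meval0.
  - rewrite lineX derivD derivC add0r derivMn derivX hornerMn hornerC.
    by rewrite mderivXU rmorph_nat.
  - by rewrite (rmorphD line) derivD hornerD h1 h2 mderivD mevalD.
  - by rewrite (rmorphM line) derivM hornerD !hornerM h1 h2 !line0 mderivM mevalD !mevalM.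
rewrite -line_deriv (_ : line P = 0) ?deriv0 ?horner0 //.
by apply: poly_eq0_everywhere => t; rewrite line_eval.
Qed.

Lemma mpoly_eq0_everywhere P : (forall v, P.@[v] = 0) -> P = 0.
Proof.
have := @deg_le_msize _ _ P; move: (msize P) => d.
elim: d P => [|d IHd] P hd P0; last first.
  have dP i : P^`M(i) = 0.
    apply: IHd; last exact: mderiv_eq0_everywhere.
    by move=> m lt_m; rewrite mcoeff_deriv hd ?mul0rn // mdegD mdeg1 addn1.
  have constP : P = (P@_0%MM)%:MP.
    apply/mpolyP => m; rewrite mcoeffC; case: eqP => [->|/eqP nz_m]; first by rewrite mulr1.
    have [i nz_i] : exists i, m i != 0%N.
      apply/existsP; apply: contraNT nz_m; rewrite negb_exists => /forallP z_m.
      by apply/eqP/mnmP => i; rewrite mnm0E; apply/eqP; rewrite -[_ == _]negbK.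
    have /eqP := congr1 (mcoeff (m - U_(i))%MM) (dP i).
    rewrite mulr0 mcoeff_deriv mcoeff0 submK ?lep1mP //.
    by rewrite mulrn_eq0 => /eqP.
  by have := P0 (fun=> 0); rewrite constP mevalC => ->; rewrite mpolyC0.
have constP : P = (P@_0%MM)%:MP.
  apply/mpolyP => m; rewrite mcoeffC; case: eqP => [->|/eqP nz_m]; first by rewrite mulr1.
  by rewrite mulr0 hd // lt0n mdeg_eq0.
by have := P0 (fun=> 0); rewrite constP mevalC => ->; rewrite mpolyC0.
Qed.

Lemma mpoly_nonvanishing P : P != 0 -> exists v, P.@[v] != 0.
Proof.
move=> nz_P; apply: contrapT => h; case/eqP: nz_P; apply: mpoly_eq0_everywhere => v.
by apply/eqP/negPn/negP => nz; apply: h; exists v.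
Qed.

End NonVanishing.

(** The complement of [L] has at most as many elements as [D], so its coordinates get distinct
    equations of [D], each with a monomial free of [L] whose coefficient can be eliminated. *)
Lemma choose_slots (n : nat) (K : finType) (A : K -> {fset 'X_{1..n}})
    (L : {set 'I_n}) (D : {set K}) :
  {j : K & A j} -> (n <= #|L| + #|D|)%N ->
  (forall j, j \in D -> exists a : A j, forall l, l \in L -> (val a : 'X_{1..n}) l = 0%N) ->
  exists y : 'I_n -> {j : K & A j},
    [/\ forall i l, i \notin L -> l \in L -> mnm_of (y i) l = 0%N,
        forall i i', i \notin L -> i' \notin L -> tag (y i) = tag (y i') -> i = i' &
        forall i, i \notin L -> tag (y i) \in D].
Proof.
move=> t0 le_n hD.
have card_CL : (#|~: L| <= #|D|)%N by have := cardsC L; rewrite card_ord; lia.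
pose s i := nth (tag t0) (enum D) (index i (enum (~: L))).
have lt_s i : i \notin L -> (index i (enum (~: L)) < size (enum D))%N.
  move=> iL; rewrite -cardE; apply: leq_trans card_CL.
  by rewrite cardE index_mem mem_enum inE.
have sD i : i \notin L -> s i \in D.
  by move=> iL; rewrite -mem_enum; apply: mem_nth; apply: lt_s.
have /choice[y hy] : forall i, exists y : {j : K & A j}, i \notin L ->
    tag y = s i /\ forall l, l \in L -> mnm_of y l = 0%N.
  move=> i; have [iL|iL] := boolP (i \in L); first by exists t0.
  by have [a ha] := hD _ (sD i iL); exists (Tagged (fun j => A j) a).
exists y; split=> [i l iL lL|i i' iL i'L|i iL].
- exact: (hy i iL).2.
- rewrite (hy i iL).1 (hy i' i'L).1 => /eqP; rewrite nth_uniq ?enum_uniq ?lt_s //.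
  move/eqP => eq_index; have mem j : j \notin L -> j \in enum (~: L).
    by move=> jL; rewrite mem_enum inE.
  by rewrite -(nth_index i (mem _ iL)) -(nth_index i (mem _ i'L)) eq_index.
- by rewrite (hy i iL).1 sD.
Qed.

Lemma mprod_off (C : comNzRingType) (n : nat) (L : {set 'I_n}) (m : 'X_{1..n}) :
  (forall l, l \in L -> m l = 0%N) ->
  exists m', 'X_[m'] * 'X_[m] = (\prod_(i in ~: L) 'X_i) ^+ mdeg m :> {mpoly C[n]}.
Proof.
move=> m_off; pose m1 := [multinom (if i \in L then 0 else mdeg m)%N | i < n].
have le_m : (m <= m1)%MM.
  apply/mnm_lepP => i; rewrite mnmE; case: ifP => [/m_off->//|_].
  by rewrite mdegE (bigD1 i) //= leq_addr.
exists (m1 - m)%MM; rewrite -mpolyXD submK // mpolyXE_id -prodrXl [LHS](bigID (mem (~: L))) /=.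
rewrite [X in _ * X]big1 ?mulr1 => [|i]; last first.
  by rewrite inE negbK mnmE => ->; rewrite expr0.
by apply: eq_bigr => i; rewrite inE mnmE => /negPf->.
Qed.

Lemma stratum_remainder (S : comNzRingType) (I : finType) (L : {set I})
    (x h q : I -> S) (a b u : S) :
  b * u = \sum_i q i * (if i \in L then x i else h i) ->
  u * (a * b) - \sum_(l in L) x l * (a * q l) = \sum_(i | i \notin L) a * q i * h i.
Proof.
move=> def_bu; rewrite mulrCA [u * b]mulrC def_bu mulr_sumr (bigID (mem L)) /=.
have -> : \sum_(i in L) a * (q i * (if i \in L then x i else h i)) =
    \sum_(l in L) x l * (a * q l).
  by apply: eq_bigr => l ->; rewrite mulrA mulrC.
rewrite [X in X - _]addrC addrK; apply: eq_bigr => i /negPf->; by rewrite mulrA.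
Qed.

(** Over the ring of universal coefficients [Q] is itself a nonzero constant, so for a coordinate
    [i] off [L] the factor [Q%:MP + 'X_i * H] of [incidence_generic] is nonzero at the origin, as
    [origin_radical] requires. A multiplier nonzero at the origin, times ['X_[m]], has lowest
    monomial [m]. *)
Lemma initials_universal (C : fieldType) (n : nat) (K : finType)
    (A : K -> {fset 'X_{1..n}}) :
  (forall L : {set 'I_n}, L != setT ->
     (n <= #|L| + #|[set j : K |
       [exists a : A j, [forall l in L, (val a : 'X_{1..n}) l == 0%N]]]|)%N) ->
  exists d, forall m, (d <= mdeg m)%N -> initials (univ C A) m.
Proof.
move=> hA.
have radX : forall i, rad (univ C A) (fun=> 0) 'X_i.
  apply: origin_radical => L neq_L.
  have := hA L neq_L; set D := [set j | _] => le_n.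
  have exD j : j \in D -> exists a : A j, forall l, l \in L -> (val a : 'X_{1..n}) l = 0%N.
    rewrite inE => /existsP[a /forallP ha]; exists a => l lL; apply/eqP.
    exact: (implyP (ha l)).
  have [i iL] : exists i, i \notin L.
    apply/existsP; rewrite -negb_forall; apply: contra neq_L => /forallP h.
    by apply/eqP/setP => i; rewrite inE h.
  have t0 : inhabited {j : K & A j}.
    have : (0 < #|D|)%N.
      rewrite lt0n; apply: contraTneq le_n => ->; rewrite addn0 -ltnNge.
      by rewrite -[ltnRHS]card_ord -cardsT proper_card // properEneq neq_L subsetT.
    case/card_gt0P => j /exD[a _]; exact: inhabits (Tagged (fun j => A j) a).
  case: t0 => t0; have [y [y_off y_inj _]] := choose_slots t0 le_n exD.
  have nz_Xi : elim C L y 'X_i != 0.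
    rewrite elimXU tofrac_eq0 /coord (negPf iL) -msize_poly_eq0 msizeX //.
  have [Q [m [H [nzQ m_off [q def_q]]]]] := incidence_generic y_off y_inj nz_Xi.
  have [m' def_m'] := @mprod_off {mpoly C[#|{: {j : K & A j}}|]} n L m m_off.
  exists (mdeg m), (Q%:MP + 'X_i * H), (fun l => 'X_[m'] * q l); split.
    by rewrite mevalD mevalM mevalXU mul0r addr0 mevalC.
  apply: loc_ideal; rewrite -def_m' (stratum_remainder _ def_q).
  apply: ideal_sum => l lL; apply: idealMl; exact: ideal_gen.
have [d hd] := origin_monomials radX; exists d => m /hd[u nz_u iu].
exists (u * 'X_[m]) => //.
have vX : vanish_below m ('X_[m] : {mpoly {mpoly C[#|{: {j : K & A j}}|]}[n]}).
  by move=> k lt_k; rewrite mcoeffX gt_eqF.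
split; last exact: vanish_belowM.
by rewrite mcoeffM_initial // mcoeffX eqxx mulr1 mcoeff0_meval.
Qed.

Lemma idealp_full (C : fieldType) (n d N : nat) (J : finType) (g : J -> {mpoly C[n]}) :
  (forall m, (d <= mdeg m < N)%N -> exists2 p, ideal g p & initial m p) ->
  forall p, ord_ge d p -> idealp g N p.
Proof.
move=> h; apply: (@initial_ind _ _ N) => [p op _|p e lt_e [nz_e vp] IH op].
  exact: idealp_ord.
have le_e : (d <= mdeg e)%N.
  by rewrite leqNgt; apply: contra nz_e => /op->.
have [|q iq [nz_q vq]] := h e; first by rewrite le_e.
have -> : p = (p - (p@_e / q@_e) *: q) + (p@_e / q@_e) *: q by rewrite subrK.
apply: idealpD; last by apply: idealp_ideal; rewrite -mul_mpolyC; apply: idealMl.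
have vq' : vanish_below e (- ((p@_e / q@_e) *: q)).
  by apply: vanish_belowN; rewrite -mul_mpolyC; apply: vanish_belowM.
apply: IH.
- exact: vanish_belowD.
- by rewrite mcoeffB mcoeffZ divfK // subrr.
- apply: ord_geD => // m lt_m; apply: vq'; apply: lt_mdeg_ltmc.
  exact: leq_trans lt_m le_e.
Qed.

(** The truncation [d.+1] just covers degree [d], where all monomials are lowest monomials; this
    feeds Nakayama's lemma in [loc_v]. That [d], [P] and [Q] are chosen before [gam] is what makes
    different systems comparable. *)
Lemma generic_initials (C : fieldType) (r : nat) (K : finType)
    (B : K -> {fset 'X_{1..r}}) :
  (forall L : {set 'I_r}, L != setT ->
     (r <= #|L| + #|[set j : K |
       [exists a : B j, [forall l in L, (val a : 'X_{1..r}) l == 0%N]]]|)%N) ->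
  exists d (P : pred 'X_{1..r}), exists2 Q : {mpoly C[#|{: {j : K & B j}}|]}, Q != 0 &
  forall gam : 'I__ -> {mpoly C[r]}, Q.@[fun k => (gam k)@_0%MM] != 0 ->
    (forall e, (mdeg e < d.+1)%N ->
      (P e <-> exists2 p, ideal (fun j => subst gam (univ C B j)) p & initial e p)) /\
    (forall p, ord_ge d p -> idealp (fun j => subst gam (univ C B j)) d.+1 p).
Proof.
move=> hB; have [d hd] := initials_universal C hB.
have [Q nzQ hQ] := initial_subst (univ C B) d.+1.
exists d, (fun e => `[<initials (univ C B) e>]), Q => // gam nz_gam.
split=> [e lt_e|].
  by apply: iff_trans (hQ gam nz_gam e lt_e); split=> [/asboolP|] // h; apply/asboolP.
apply: idealp_full => m /andP[le_m lt_m]; apply/(hQ gam nz_gam m lt_m); exact: hd.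
Qed.

Section Origin.
Variables (R : realType) (n : nat).
Implicit Types (P : {mpoly R[i][n]}) (z : 'I_n -> R[i]).

Lemma meval_near0 P : exists M : R, 0 < M /\ forall (del : R) z, 0 <= del <= 1 ->
  (forall i, `|z i| <= del%:C) -> `|P.@[z] - P.@[fun=> 0]| <= (M * del)%:C.
Proof.
have reC (x : R[i]) : exists2 a : R, 0 <= a & `|x| = a%:C.
  exists (complex.Re `|x|); last by rewrite RRe_real ?normr_real.
  by rewrite -lecR RRe_real ?normr_real // normr_ge0.
move: P; apply: mpoly_ring_ind
  => [c|i|P Q [M [M0 hM]] [M' [M0' hM']]|P Q [M [M0 hM]] [M' [M0' hM']]].
- exists 1; split=> [|del z /andP[del0 _] _]; first exact: ltr01.
  by rewrite !mevalC subrr normr0 mul1r lecR.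
- exists 1; split=> [|del z _ hz]; first exact: ltr01.
  by rewrite !mevalXU subr0 mul1r.
- exists (M + M'); split=> [|del z hdel hz]; first exact: addr_gt0.
  rewrite !mevalD opprD addrACA mulrDl rmorphD /=.
  apply: le_trans (ler_normD _ _) _; apply: lerD; [exact: hM | exact: hM'].
have [a a0 def_a] := reC P.@[fun=> 0]; have [b b0 def_b] := reC Q.@[fun=> 0].
exists ((a + M) * M' + M * b + 1); split=> [|del z /andP[del0 del1] hz].
  by apply: ltr_wpDl => //; rewrite addr_ge0 ?mulr_ge0 ?addr_ge0 // ltW.
have hP := hM del z; have hQ := hM' del z.
have {}hP : `|P.@[z] - P.@[fun=> 0]| <= (M * del)%:C by apply: hP; rewrite ?del0.
have {}hQ : `|Q.@[z] - Q.@[fun=> 0]| <= (M' * del)%:C by apply: hQ; rewrite ?del0.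
have Pz : `|P.@[z]| <= (a + M)%:C.
  rewrite -(subrK P.@[fun=> 0] P.@[z]) addrC; apply: le_trans (ler_normD _ _) _.
  rewrite def_a rmorphD /= lerD2l; apply: le_trans hP _; rewrite lecR.
  by rewrite ler_piMr // ltW.
rewrite !mevalM mul_subMM addrC; apply: le_trans (ler_normD _ _) _.
apply: (@le_trans _ _ ((a + M)%:C * (M' * del)%:C + (M * del)%:C * b%:C)).
  rewrite !normrM def_b; apply: lerD; first by rewrite ler_pM.
  by rewrite ler_wpM2r // lecR.
rewrite -!rmorphM -rmorphD /= lecR.
have -> : ((a + M) * M' + M * b + 1) * del =
  (a + M) * (M' * del) + M * del * b + del by ring.
by rewrite lerDl.
Qed.

Lemma nonvanishing_near0 P : P.@[fun=> 0] != 0 ->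
  exists2 e : R, 0 < e & forall z, (forall i, `|z i| < e%:C) -> P.@[z] != 0.
Proof.
move=> nz; have [M [M0 hM]] := meval_near0 P.
have [a a0 def_a] : exists2 a : R, 0 < a & `|P.@[fun=> 0]| = a%:C.
  exists (complex.Re `|P.@[fun=> 0]|); last by rewrite RRe_real ?normr_real.
  by rewrite -ltcR RRe_real ?normr_real // normr_gt0.
(* Within this radius [P] moves by at most half of [a], the modulus of its value at the origin. *)
exists (Num.min 1 (a / (M *+ 2))).
  by rewrite lt_min ltr01 divr_gt0 // mulrn_wgt0.
move=> z hz; apply/eqP => Pz0.
have := hM (Num.min 1 (a / (M *+ 2))) z; rewrite Pz0 sub0r normrN def_a.
move=> h; have /h : 0 <= Num.min 1 (a / (M *+ 2)) <= 1.
  by rewrite ge_min lexx /= le_min ler01 divr_ge0 ?mulrn_wge0 ?ltW.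
move/(_ (fun i => ltW (hz i))); rewrite lecR => le_a.
have : a <= M * (a / (M *+ 2)).
  by apply: le_trans le_a _; rewrite ler_pM2l // ge_min lexx orbT.
rewrite mulrC -mulr_natr invfM mulrA -mulrA [_^-1 * _]mulrC mulrA divfK ?gt_eqF //.
by rewrite leNgt ltr_pdivrMr // ltr_pMr // ltr1n.
Qed.

Lemma isolated_origin (K : finType) (f : K -> {mpoly R[i][n]}) (d : nat) :
  (forall j, (f j).@[fun=> 0] = 0) ->
  (forall i, loc f (fun=> 0) ('X_i ^+ d)) -> isolated_zero f (fun=> 0).
Proof.
move=> f0 hX; split=> //.
have /choice[u hu] : forall i, exists u : {mpoly R[i][n]},
    u.@[fun=> 0] != 0 /\ ideal f (u * 'X_i ^+ d).
  by move=> i; have [u] := hX i; exists u.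
have [|e e0 he] := @nonvanishing_near0 (\prod_i u i).
  by rewrite rmorph_prod; apply/prodf_neq0 => i _; have [] := hu i.
exists e => // z hz zz i.
have := he z; rewrite rmorph_prod => nz_z.
have /prodf_neq0 nz_u : \prod_l (u l).@[z] != 0.
  by apply: nz_z => l; have := hz l; rewrite subr0.
have [_ [q def_q]] := hu i; have := congr1 (meval z) def_q.
rewrite mevalM rmorphXn /= mevalXU rmorph_sum /= big1 => [/eqP|j _]; last first.
  by rewrite mevalM zz mulr0.
by rewrite mulf_eq0 (negPf (nz_u i isT)) expf_eq0 => /andP[_ /eqP].
Qed.

End Origin.

Lemma spec_univ (R : realType) (n : nat) (K : finType) (A : K -> {fset 'X_{1..n}})
    (c : coeffs R A) j :
  spec (fun k => c (enum_val k)) (univ _ A j) = sparse_system c j.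
Proof.
rewrite (raddf_sum (spec (fun k => c (enum_val k)))); apply: eq_bigr => a _ /=.
by rewrite specZ specX mevalXU enum_rankK.
Qed.

Lemma subst_univ (C : fieldType) (n : nat) (K : finType) (A : K -> {fset 'X_{1..n}})
    (gam : 'I_#|{: {j : K & A j}}| -> {mpoly C[n]}) j :
  subst gam (univ C A j) =
  \sum_(a : A j) gam (enum_rank (Tagged (fun j => A j) a)) * 'X_[val a].
Proof.
rewrite (raddf_sum (subst gam)); apply: eq_bigr => a _ /=.
by rewrite -mul_mpolyC rmorphM /= substC substX /subst_coef mmapX mmap1U.
Qed.

(** The case of [loc_transfer] where all coordinates are free, so that the expansion is the
    identity. *)
Lemma has_multiplicity_origin (R : realType) (r : nat) (K : finType)
    (B : K -> {fset 'X_{1..r}}) (c : coeffs R B) (d : nat) (P : pred 'X_{1..r}) :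
  (forall j (a : B j), val a != 0%MM) ->
  (forall e, (mdeg e < d.+1)%N ->
    (P e <-> exists2 p, ideal (sparse_system c) p & initial e p)) ->
  (forall p, ord_ge d p -> idealp (sparse_system c) d.+1 p) ->
  isolated_zero (sparse_system c) (fun=> 0) /\
  has_multiplicity (sparse_system c) (fun=> 0) #|[set m : 'X_{1..r < d.+1} | ~~ P m]|.
Proof.
move=> nz_B hP hd; pose X i : {mpoly R[i][r]} := 'X_i.
have transfer Q : idealp (sparse_system c) d.+1 (peval X Q) <->
    loc (sparse_system c) (fun=> 0) Q.
  apply: (@loc_transfer _ _ _ id (fun=> 0) X) => //.
  - rewrite (_ : \matrix_(i, l) _ = 1%:M) ?det1 ?oner_neq0 //.
    by apply/matrixP => i l; rewrite !mxE /X mderivXU rmorph_nat.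
  - by move=> i; rewrite /X mcoeffX mnm1_eq0.
  - by move=> i /(_ i); rewrite eqxx.
  - by move=> i /(_ i); rewrite eqxx.
  - by move=> j; rewrite peval_id; apply/idealp_ideal/ideal_gen.
  - by move=> j; exists (sparse_system c j); [exact: ideal_gen | rewrite peval_id].
  - by move=> m deg_m; apply: hd; apply: ord_geX; rewrite deg_m.
split.
  apply: (@isolated_origin _ _ _ _ d) => [j|i].
    rewrite -mcoeff0_meval raddf_sum /= big1 // => a _.
    by rewrite mcoeffZ mcoeffX (negPf (nz_B j a)) mulr0.
  apply/transfer; rewrite peval_id; apply: hd; rewrite mpolyXn; apply: ord_geX.
  by rewrite mdegMn mdeg1 mul1n.
apply: (@has_multiplicity_quotient _ _ _ _ _ _ _ _ (peval X) id) => //.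
- by move=> a; rewrite pevalC.
- by move=> p; rewrite peval_id.
- by move=> p; rewrite peval_id mcoeff0_meval.
Qed.

(** * The residual system *)

Section Residual.
Variables (n : nat) (A : 'I_n -> {fset 'X_{1..n}}) (I : {set 'I_n}).
Local Notation K := {j : 'I_n | j \notin J_ A I}.

Definition residual (j : K) : {fset 'X_{1..#|I|}} := proj_supp I (A (val j)).

Lemma J_P (I' : {set 'I_n}) j :
  reflect (exists a : A j, forall i, i \in I' -> (val a : 'X_{1..n}) i = 0%N)
    (j \in J_ A I').
Proof.
rewrite inE; apply: (iffP existsP) => -[a ha]; exists a.
  by move=> i iI; apply/eqP; apply: (implyP (forallP ha i)).
by apply/forallP => i; apply/implyP => iI; rewrite ha.
Qed.

Lemma J_subset (I' : {set 'I_n}) : I' \subset I -> J_ A I \subset J_ A I'.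
Proof.
move=> /subsetP sub; apply/subsetP => j /J_P[a ha]; apply/J_P; exists a => i iI'.
by apply/ha/sub.
Qed.

Lemma proj_residual (j : K) (a : A (val j)) :
  proj_mnm I (val a : 'X_{1..n}) \in residual j.
Proof. by apply/imfsetP; exists (val a) => //=; apply: valP. Qed.

Lemma residual_neq0 (j : K) (b : residual j) : val b != 0%MM :> 'X_{1..#|I|}.
Proof.
apply/eqP => b0; have /imfsetP[a /= aA def_b] := valP b.
have := valP j; rewrite /= => /negP[]; apply/J_P; exists [` aA]%fset => i iI /=.
have /mnmP/(_ (enum_rank_in iI i)) := etrans (esym def_b) b0; rewrite mnm0E mnmE.
by rewrite enum_rankK_in.
Qed.

(** For [L] inside [I], (A1) and (A2) leave at least [#|I| - #|L|] equations in [J_ A L] outside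
    [J_ A I], and each has a projected monomial free of [L]. *)
Lemma residual_count :
  (#|I| + #|J_ A I| = n)%N ->
  (forall I' : {set 'I_n}, I' \subset I -> (n <= #|I'| + #|J_ A I'|)%N) ->
  forall L : {set 'I_#|I|}, (#|I| <= #|L| + #|[set j : K |
    [exists b : residual j, [forall l in L, (val b : 'X_{1..#|I|}) l == 0%N]]]|)%N.
Proof.
move=> A1 A2 L; set D := [set j | _].
pose I' := [set enum_val l | l in L].
have sI' : I' \subset I by apply/subsetP => _ /imsetP[l _ ->]; apply: enum_valP.
have cI' : #|I'| = #|L| by rewrite card_imset //; apply: enum_val_inj.
have sub : J_ A I' :\: J_ A I \subset [set val j | j in D].
  apply/subsetP => j; rewrite inE => /andP[jI /J_P[a ha]].
  apply/imsetP; exists (exist _ j jI) => //; rewrite inE; apply/existsP.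
  exists [` proj_residual (j := exist _ j jI) a]%fset; apply/forallP => l.
  by apply/implyP => lL /=; rewrite mnmE ha //; apply/imsetP; exists l.
have := subset_leq_card sub; rewrite card_imset; last exact: val_inj.
have := A2 _ sI'; rewrite cI'; have := cardsID (J_ A I) (J_ A I').
have -> : J_ A I' :&: J_ A I = J_ A I by apply/setIidPr/J_subset.
move=> <- le1 le2; rewrite -(leq_add2r #|J_ A I|) A1; apply: leq_trans le1 _.
by rewrite [X in (_ <= X)%N]addnAC -!addnA !leq_add2l.
Qed.

End Residual.

Section GenericResidual.
Variables (C : numFieldType) (n : nat) (A : 'I_n -> {fset 'X_{1..n}}) (I : {set 'I_n}).
Local Notation K := {j : 'I_n | j \notin J_ A I}.
Local Notation T := {j : 'I_n & A j}.
Local Notation Tr := {j : K & residual j}.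
Local Notation tag_of a := (Tagged (fun j => A j) a).
Variable y : 'I_n -> T.
Hypothesis y_J : forall i, i \notin I -> tag (y i) \in J_ A I.

(* The coefficients of the residual system at a zero with coordinates off I
   given by x; its monomial b collects the a with projection b. *)
Definition residual_coef (S : comNzRingType) (c : T -> S) (x : 'I_n -> S) (s : Tr) : S :=
  \sum_(a : A (val (tag s)) | proj_mnm I (val a : 'X_{1..n}) == val (tagged s))
    c (tag_of a) * \prod_(i in ~: I) x i ^+ (val a : 'X_{1..n}) i.

Lemma rmorph_residual_coef (S S' : comNzRingType) (h : {rmorphism S -> S'}) c x s :
  h (residual_coef c x s) = residual_coef (h \o c) (h \o x) s.
Proof.
rewrite rmorph_sum; apply: eq_bigr => a _ /=.
by rewrite rmorphM rmorph_prod; congr (_ * _); apply: eq_bigr => i _; rewrite rmorphXn.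
Qed.

Lemma eq_residual_coef (S : comNzRingType) (c c' : T -> S) (x x' : 'I_n -> S) s :
  (forall a : A (val (tag s)), c (tag_of a) = c' (tag_of a)) ->
  (forall i, i \notin I -> x i = x' i) ->
  residual_coef c x s = residual_coef c' x' s.
Proof.
move=> eq_c eq_x; apply: eq_bigr => a _; rewrite eq_c; congr (_ * _).
by apply: eq_bigr => i; rewrite inE => /eq_x->.
Qed.

(** Each [v s] is put on one chosen monomial projecting to [s], the other coefficients of residual
    equations being 0. Equations in [J_ A I] get coefficients 1, so that the slots [y i], which
    store the coordinates, hold 1. *)
Lemma residual_coef_surj (v : Tr -> C) : exists w : T -> C,
  (forall i, i \notin I -> w (y i) = 1) /\
  forall s, residual_coef w (fun=> 1) s = v s.
Proof.
have ex_rep (s : Tr) : exists a : A (val (tag s)),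
    proj_mnm I (val a : 'X_{1..n}) = val (tagged s).
  by have /imfsetP[a /= aA def_s] := valP (tagged s); exists [` aA]%fset.
pose rep (s : Tr) : T := tag_of (projT1 (cid (ex_rep s))).
have repP s : proj_mnm I (mnm_of (rep s)) = val (tagged s) := projT2 (cid (ex_rep s)).
have rep_inj (s : Tr) (a : A (val (tag s))) (s' : Tr) :
    proj_mnm I (val a : 'X_{1..n}) = val (tagged s) -> rep s' = tag_of a -> s' = s.
  move=> proj_a eq_rep.
  have eq_tag : tag s' = tag s.
    by apply: val_inj; have := congr1 (fun t : T => tag t) eq_rep.
  have : val (tagged s') = val (tagged s) by rewrite -repP -proj_a eq_rep.
  move: eq_tag {repP a proj_a eq_rep}; case: s s' => j b [j' b'] /= eq_j.
  by subst j' => /val_inj->.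
exists (fun t => (tag t \in J_ A I)%:R + \sum_s v s *+ (rep s == t)); split=> [i iI|s].
  rewrite y_J // big1 ?addr0 // => s _; case: eqP => // eq_rep.
  have := valP (tag s); have := y_J iI; rewrite -eq_rep /=.
  by move=> ->.
rewrite /residual_coef.
have w_tag (a : A (val (tag s))) : proj_mnm I (val a : 'X_{1..n}) == val (tagged s) ->
    (tag (tag_of a) \in J_ A I)%:R + \sum_s' v s' *+ (rep s' == tag_of a) =
    v s *+ (rep s == tag_of a).
  move=> /eqP proj_a; have /negPf -> /= := valP (tag s); rewrite add0r (bigD1 s) //=.
  rewrite big1 ?addr0 // => s' neq; case: eqP => // /(rep_inj _ _ _ proj_a) eq_s.
  by rewrite eq_s eqxx in neq.
have [a0 def_a0] : exists a0 : A (val (tag s)), rep s = tag_of a0.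
  by exists (projT1 (cid (ex_rep s))).
transitivity (\sum_(a : A (val (tag s)) | proj_mnm I (val a : 'X_{1..n}) == val (tagged s))
    v s *+ (rep s == tag_of a)).
  apply: eq_bigr => a /w_tag w_a; rewrite [X in _ * X]big1 ?mulr1 //.
  by move=> i _; rewrite expr1n.
rewrite (bigD1 a0) /=; last by have := repP s; rewrite def_a0 => /eqP.
rewrite def_a0 eqxx mulr1n big1 ?addr0 // => a /andP[_ neq_a].
by rewrite eq_Tagged eq_sym (negPf neq_a) mulr0n.
Qed.

End GenericResidual.

Section LiftResidual.
Variables (C : numFieldType) (n : nat) (A : 'I_n -> {fset 'X_{1..n}}) (I : {set 'I_n}).
Local Notation K := {j : 'I_n | j \notin J_ A I}.
Local Notation T := {j : 'I_n & A j}.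
Local Notation Tr := {j : K & residual j}.
Local Notation Co := {mpoly C[#|{: T}|]}.
Variable y : 'I_n -> T.
Hypothesis y_J : forall i, i \notin I -> tag (y i) \in J_ A I.

(** A polynomial condition on the residual coefficients, viewed as a function of the full
    coefficients and the point. *)
Definition lift_residual : {rmorphism {mpoly C[#|{: Tr}|]} -> {mpoly Co[n]}} :=
  mmap (@mpolyC n Co \o @mpolyC #|{: T}| C)
    (fun k => residual_coef (fun t : T => ('X_(enum_rank t) : Co)%:MP)
                (fun i => 'X_i) (enum_val k)).

Lemma lift_residualC a : lift_residual a%:MP = a%:MP%:MP.
Proof. exact: mmapC. Qed.

Lemma lift_residualX k : lift_residual 'X_k =
  residual_coef (fun t : T => ('X_(enum_rank t) : Co)%:MP) (fun i => 'X_i) (enum_val k).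
Proof. by rewrite [LHS]mmapX mmap1U. Qed.

Opaque lift_residual.

Lemma spec_lift_residual Q c z : (spec c (lift_residual Q)).@[z] =
  Q.@[fun k => residual_coef (fun t => c (enum_rank t)) z (enum_val k)].
Proof.
move: Q; apply: (@eq_rmorph_mpoly _ _ _ (meval z \o (spec c \o lift_residual))
  (meval _)) => [a|k] /=.
  by rewrite lift_residualC specC !mevalC.
rewrite lift_residualX mevalXU.
apply: etrans (rmorph_residual_coef (meval z \o spec c) _ _ _) _.
by apply: eq_residual_coef => [a|i _] /=; rewrite ?specC ?specX ?mevalC mevalXU.
Qed.

Lemma elim_lift_residual Q : elim C I y (lift_residual Q) =
  tofrac (peval (fun k => residual_coef (fun t => 'X_(enum_rank t)) (coord C I y)
                            (enum_val k)) Q).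
Proof.
move: Q; apply: (@eq_rmorph_mpoly _ _ _ (elim C I y \o lift_residual)
  (@tofrac _ \o peval _)) => [a|k].
  by rewrite /= lift_residualC elimC elim_coefC pevalC.
rewrite /= lift_residualX pevalXU (rmorph_residual_coef (elim C I y)).
rewrite (rmorph_residual_coef (@tofrac _)).
apply: eq_residual_coef => [a|i _] /=; last exact: elimXU.
rewrite elimC elim_coefX enum_rankK.
have [[i [iI yi _]]|[_ ->]//] := slotP I y (Tagged (fun j => A j) a).
by have := y_J iI; rewrite yi /= (negPf (valP (tag (enum_val k)))).
Qed.

(** Once the coordinates are set to 1, the residual coefficients take any values, in particular
    those of a point where [Q] is nonzero. *)
Lemma elim_lift_residual_neq0 Q : Q != 0 -> elim C I y (lift_residual Q) != 0.
Proof.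
move=> nzQ; have [v nz_v] := mpoly_nonvanishing nzQ.
have [w [w_y w_res]] := residual_coef_surj y_J (fun s => v (enum_rank s)).
rewrite elim_lift_residual tofrac_eq0; apply: contraNneq nz_v => z_Q.
have := congr1 (meval (fun k => w (enum_val k))) z_Q.
rewrite meval0 meval_peval => <-; apply/eqP/meval_eq => k.
rewrite (rmorph_residual_coef (meval _)) -{1}(enum_valK k) -w_res.
apply: eq_residual_coef => [a|i iI] /=; first by rewrite mevalXU enum_rankK.
by rewrite /coord (negPf iI) mevalXU enum_rankK w_y.
Qed.

End LiftResidual.

(** The factors of a monomial in [I] become variables, those off [I] go into the coefficient, and
    the terms are grouped by projection. *)
Lemma peval_residual (C : fieldType) (n : nat) (A : 'I_n -> {fset 'X_{1..n}})
    (I : {set 'I_n}) (c : {j : 'I_n & A j} -> C) (X : 'I_n -> {mpoly C[#|I|]})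
    (j : {j : 'I_n | j \notin J_ A I}) :
  (forall k, X (enum_val k) = 'X_k) ->
  \sum_(b : residual j) residual_coef (fun t => (c t)%:MP) X
     (Tagged (fun j => residual j) b) * 'X_[val b] =
  peval X (\sum_(a : A (val j)) c (Tagged (fun j => A j) a) *: 'X_[val a]).
Proof.
move=> X_e; rewrite (raddf_sum (peval X)) /=.
pose h (a : A (val j)) : residual j := [` proj_residual a]%fset.
rewrite (partition_big h xpredT) //=; apply: eq_bigr => b _.
rewrite mulr_suml; apply: eq_big => [a|a /eqP proj_a]; first by rewrite -val_eqE.
rewrite -proj_a -mul_mpolyC (rmorphM (peval X)) pevalC -mulrA; congr (_ * _).
rewrite [in LHS]mpolyXE_id [in RHS]mpolyXE_id (rmorph_prod (peval X)) /= mulrC.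
rewrite [RHS](bigID (mem I)) /=; congr (_ * _).
  rewrite [RHS]big_enum_val; apply: eq_bigr => k _.
  by rewrite (rmorphXn (peval X)) /= pevalXU X_e mnmE.
apply: eq_big => [i|i _]; first by rewrite inE.
by rewrite (rmorphXn (peval X)) /= pevalXU.
Qed.

Lemma generically_nonvanishing (R : realType) (n : nat) (K : finType)
    (A : K -> {fset 'X_{1..n}}) (P : (K -> {mpoly R[i][n]}) -> Prop)
    (Q : {mpoly R[i][#|{: {j : K & A j}}|]}) :
  Q != 0 ->
  (forall c : coeffs R A, Q.@[fun k => c (enum_val k)] != 0 -> P (sparse_system c)) ->
  generically (R := R) A P.
Proof.
(* The product of all variables forces the coefficients to be nonzero. *)
move=> nzQ hP; pose Q' := Q * \prod_k 'X_k.
have nzQ' : Q' != 0.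
  rewrite mulf_neq0 //; apply/prodf_neq0 => k _.
  by rewrite -msize_poly_eq0 msizeX.
exists (fun c => Q'.@[fun k => c (enum_val k)] != 0); split.
- exists (fun p => p = Q') => c; split=> [nz|[p -> //]]; by exists Q'.
- have [v nz_v] := mpoly_nonvanishing nzQ'; exists (fun t => v (enum_rank t)).
  by rewrite (meval_eq (v2 := v)) // => k; rewrite enum_valK.
move=> c; rewrite mevalM rmorph_prod mulf_eq0 negb_or => /andP[nzQc /prodf_neq0 nz_c].
split=> [t|]; last exact: hP.
by have := nz_c (enum_rank t) isT; rewrite /= mevalXU enum_rankK.
Qed.

Lemma multiplicity_at_stratum (R : realType) (n : nat) (A : 'I_n -> {fset 'X_{1..n}})
    (I : {set 'I_n}) :
  I != set0 -> (#|I| + #|J_ A I| = n)%N ->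
  (forall I' : {set 'I_n}, I' \subset I -> (n <= #|I'| + #|J_ A I'|)%N) ->
  exists2 Q : {mpoly R[i][#|{: {j : 'I_n & A j}}|]}, Q != 0 &
  forall c : coeffs R A, Q.@[fun k => c (enum_val k)] != 0 ->
  forall z, is_zero (sparse_system c) z -> in_O I z -> exists mu,
    has_multiplicity (sparse_system c) z mu /\
    generically (R := R) (@residual n A I)
      (fun g => isolated_zero g (fun=> 0) /\ has_multiplicity g (fun=> 0) mu).
Proof.
move=> nzI A1 A2.
have [t0] : inhabited {j : 'I_n & A j}.
  have [i0 _] := set0Pn _ nzI.
  have : (0 < #|J_ A set0|)%N.
    have := A2 set0 (sub0set _); rewrite cards0 add0n; apply: leq_trans.
    by case: (n) i0 => [[]|].
  by case/card_gt0P => j /J_P[a _]; exact: inhabits (Tagged (fun j => A j) a).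
have [||y [y_off y_inj y_J]] := @choose_slots n _ A I (J_ A I) t0; first by rewrite A1.
  by move=> j /J_P.
(* By (A1) the slots are in bijection with [J_ A I], so every equation there is among the [gens] and
   will vanish along the expansion to order [d.+1]. *)
have y_surj j : j \in J_ A I -> exists2 i, i \notin I & tag (y i) = j.
  have : [set tag (y i) | i in ~: I] = J_ A I.
    apply/eqP; rewrite eqEcard; apply/andP; split.
      by apply/subsetP => _ /imsetP[i iI ->]; apply: y_J; move: iI; rewrite inE.
    rewrite card_in_imset => [|i i']; last by rewrite !inE; apply: y_inj.
    by have := cardsC I; rewrite card_ord -[in RHS]A1 => /addnI->.
  by move=> <- /imsetP[i iI ->]; exists i => //; move: iI; rewrite inE.
(* The same [d], [P] and [Qr] serve the full system expanded at [z] and a generic residual system at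
   the origin, so both multiplicities count the same standard monomials. *)
have [d [P [Qr nzQr hQr]]] := @generic_initials R[i] _ _ (@residual n A I)
  (fun L _ => residual_count A1 A2 L).
have [Q1 nzQ1 hQ1] := @stratum_jacobian R[i] _ _ A I y y_off y_inj.
have [Q2 nzQ2 hQ2] := @stratum_generic R[i] _ _ A I y y_off y_inj _
  (elim_lift_residual_neq0 y_J nzQr).
exists (Q1 * Q2); first by rewrite mulf_neq0.
move=> c; rewrite mevalM mulf_eq0 negb_or => /andP[nzQ1c nzQ2c] z zz zO.
pose c' (k : 'I_#|{: {j : 'I_n & A j}}|) := c (enum_val k).
have spec_gens i : spec c' (gens _ I y i) =
    if i \in I then 'X_i else sparse_system c (tag (y i)).
  by rewrite /gens; case: ifP => _; rewrite ?specX ?spec_univ.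
have sz : stratum_zero I y c' z.
  split=> [i iI|i]; first by apply/eqP => /zO; apply/negP.
  by rewrite spec_gens; case: ifP => [iI|_]; rewrite ?zz // mevalXU; apply/zO.
have nz_det := hQ1 _ _ nzQ1c sz; have nz_res := hQ2 _ _ nzQ2c sz.
pose e (k : 'I_#|I|) := enum_val k : 'I_n.
have e_inj : injective e := enum_val_inj.
have eI k : e k \in I := enum_valP k.
have e_off i : (forall k, e k != i) -> i \notin I.
  by move=> off; apply/negP => iI; have := off (enum_rank_in iI i);
    rewrite /e enum_rankK_in // eqxx.
have z_e k : z (e k) = 0 by apply/zO.
have G_e k : spec c' (gens _ I y (e k)) = 'X_(e k) by rewrite spec_gens eI.
have [X [X0 X_e XG]] := implicit_solution e_inj z_e G_e sz.2 nz_det d.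
(* Residual coefficients along the expansion [X]; their constant terms are the residual coefficients
   at [z], where [Q2] keeps [Qr] nonzero. *)
pose gam (k : 'I_#|{: {j : {j : 'I_n | j \notin J_ A I} & residual j}}|) :=
  residual_coef (fun t => (c t)%:MP) X (enum_val k).
have gam0 : Qr.@[fun k => (gam k)@_0%MM] != 0.
  move: nz_res; rewrite spec_lift_residual; congr (_ != 0); apply: meval_eq => k.
  rewrite /gam (rmorph_residual_coef (mcoeff 0%MM)).
  apply: eq_residual_coef => [a|i _] /=; last by rewrite X0.
  by rewrite /c' enum_rankK mcoeffC eqxx mulr1.
have subst_gam j : subst gam (univ _ (@residual n A I) j) =
    peval X (sparse_system c (val j)).
  rewrite subst_univ -(peval_residual c j X_e); apply: eq_bigr => b _.
  by rewrite /gam enum_rankK.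
have [hP hd] := hQr gam gam0.
pose g j := subst gam (univ _ (@residual n A I) j).
have ordG i : (forall k, e k != i) -> ord_ge d.+1 (peval X (spec c' (gens _ I y i))).
  by move=> off; have := XG i; rewrite free_coord_off ?subr0.
exists #|[set m : 'X_{1..#|I| < d.+1} | ~~ P m]|; split.
  have transfer : forall Q, idealp g d.+1 (peval X Q) <-> loc (sparse_system c) z Q.
    apply: (loc_transfer z_e G_e nz_det X0 X_e ordG) => [i off|j|j|m deg_m].
    - by rewrite spec_gens (negPf (e_off i off)); apply: ideal_gen.
    - have [/y_surj[i iI <-]|jI] := boolP (j \in J_ A I).
        have <- : spec c' (gens _ I y i) = sparse_system c (tag (y i)).
          by rewrite spec_gens (negPf iI).
        by apply/idealp_ord/ordG => k; apply: contraNneq iI => <-.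
      apply: idealp_ideal.
      have <- : g (exist _ j jI) = peval X (sparse_system c j) by rewrite /g subst_gam.
      exact: ideal_gen.
    - by exists (sparse_system c (val j)); [exact: ideal_gen | rewrite /g subst_gam].
    - by apply: hd; apply: ord_geX; rewrite deg_m.
  apply: (@has_multiplicity_quotient _ _ _ _ _ _ _ _ (peval X) (peval (fun k => 'X_(e k))) g) => //.
  - by move=> a; rewrite pevalC.
  - exact: peval_iota X_e.
  - exact: peval_origin X0.
apply: (generically_nonvanishing nzQr) => c1 nz_c1.
(* A system with plain complex coefficients is the case of a constant substitution. *)
pose gam1 (k : 'I_#|{: {j : {j : 'I_n | j \notin J_ A I} & residual j}}|) :
  {mpoly R[i][#|I|]} := (c1 (enum_val k))%:MP.
have gam10 : Qr.@[fun k => (gam1 k)@_0%MM] != 0.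
  rewrite (meval_eq (v2 := fun k => c1 (enum_val k))) // => k.
  by rewrite /gam1 mcoeffC eqxx mulr1.
have subst_gam1 : (fun j => subst gam1 (univ _ (@residual n A I) j)) = sparse_system c1.
  apply/funext => j; rewrite subst_univ; apply: eq_bigr => b _.
  by rewrite /gam1 enum_rankK mul_mpolyC.
have [hP1 hd1] := hQr gam1 gam10; rewrite subst_gam1 in hP1 hd1.
apply: has_multiplicity_origin => // j b; exact: residual_neq0.
Qed.

Theorem theorem16 (R : realType) (n : nat) (A : 'I_n -> {fset 'X_{1..n}}) :
  generically (R := R) A (fun f =>
    forall I : {set 'I_n}, I != set0 ->
    (#|I| + #|J_ A I| = n)%N ->
    (forall I' : {set 'I_n}, I' \subset I -> (n <= #|I'| + #|J_ A I'|)%N) ->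
    (forall J : {set 'I_n}, J \subset J_ A I ->
       (#|J| <= affine_dim R (minkowski_sum (restr I A) J))%N) ->
    forall zeta : 'I_n -> R[i], isolated_zero f zeta -> in_O I zeta ->
    exists mu : nat,
      has_multiplicity f zeta mu /\
      generically (R := R)
        (fun j : {j : 'I_n | j \notin J_ A I} => proj_supp I (A (val j)))
        (fun g => isolated_zero g (fun _ => 0) /\
                  has_multiplicity g (fun _ => 0) mu)).
Proof.
(* One open set must serve every [I]: the conditions for the finitely many [I] are multiplied, with
   1 where [hyp] fails. *)
pose hyp (I : {set 'I_n}) := [/\ I != set0, (#|I| + #|J_ A I| = n)%N &
  forall I' : {set 'I_n}, I' \subset I -> (n <= #|I'| + #|J_ A I'|)%N].
have /choice[Q hQ] : forall I : {set 'I_n},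
    exists Q : {mpoly R[i][#|{: {j : 'I_n & A j}}|]}, Q != 0 /\ (hyp I ->
    forall c : coeffs R A, Q.@[fun k => c (enum_val k)] != 0 ->
    forall z, is_zero (sparse_system c) z -> in_O I z -> exists mu,
      has_multiplicity (sparse_system c) z mu /\
      generically (R := R) (@residual n A I)
        (fun g => isolated_zero g (fun=> 0) /\ has_multiplicity g (fun=> 0) mu)).
  move=> I; have [[nzI A1 A2]|no_hyp] := pselect (hyp I).
    by have [Q nzQ hQ] := @multiplicity_at_stratum R n A I nzI A1 A2; exists Q.
  by exists 1; split=> [|/no_hyp//]; apply: oner_neq0.
apply: (@generically_nonvanishing _ _ _ _ _ (\prod_I Q I)).
  by apply/prodf_neq0 => I _; have [] := hQ I.
move=> c; rewrite rmorph_prod => /prodf_neq0 nzQ I nzI A1 A2 _ zeta [zz _] zO.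
have [_ hI] := hQ I.
by apply: (hI _ c (nzQ I isT) zeta zz zO).
Qed.
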